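(* Let $(M,g)$ be a Lorentzian manifold of dimension $n\ge 3$ with a null congruence $c$, and let $S$ be its trace-free Ricci tensor, assumed to satisfy $\mathrm{bo}_c(S)\le 0$ on $M$. If at a point $p\in M$ the tensor $S$ is of generic type II with respect to $c$, in the sense that its timelike generalized eigenspace $E_\lambda$ at $p$ has dimension $2$, and if moreover $\mathrm{bo}_c(\nabla S)\le 0$, then $c$ is Kundt on an open neighborhood of $p$.
   Context: Lorentzian metrics have signature $(-,+,\dots,+)$ and $\nabla$ is the Levi-Civita connection. A null congruence $c$ (equivalently null line distribution) is a smooth rank-one subbundle of $TM$ whose fibres are null lines. With $k$ a local non-vanishing section of $c$, $c$ is Kundt (non-twisting, hence geodetic, non-shearing and non-expanding) on an open set if $X^a\nabla_a k^b\propto k^b$ for all $X\in c^\perp$ there, equivalently $k_{[a}\nabla_{b]}k_{[c}k_{d]}=0$. Boost order: for a null line $c$ in an $n$-dimensional Lorentzian vector space take a null frame $\{e_0,e_1,e_i\}=\{k,l,m_i\}$ ($2\le i\le n-1$) with $0\ne k\in c$, whose only non-zero inner products are $g(k,l)=g(m_i,m_i)=1$. The boost weight of a multi-index $\alpha_1\cdots\alpha_r$ is (number of $0$'s) minus (number of $1$'s). The boost order $\mathrm{bo}_c(T)$ of a non-zero covariant tensor $T$ is the largest boost weight of a multi-index with $T_{\alpha_1\cdots\alpha_r}=T(e_{\alpha_1},\dots,e_{\alpha_r})\ne0$ (independent of the frame); the zero tensor is regarded as having boost order $\le s$ for every $s$. Inequalities on boost orders of tensor fields are meant at every point of $M$.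 The condition $\mathrm{bo}_c(S)\le0$ means precisely that $c$ is an eigendirection of $S$, regarded as an endomorphism $S^a{}_b$ of tangent space: $S^a{}_bk^b=\lambda k^a$ for $k\in c$. $E_\lambda$ denotes the generalized eigenspace of $S$ for this eigenvalue $\lambda$; it is the unique generalized eigenspace containing timelike vectors. *)

(* Defs.v *)
From HB Require Import structures.
From mathcomp Require Import all_boot all_order all_algebra.
From mathcomp Require Import all_classical all_reals all_analysis.

Set Implicit Arguments.
Unset Strict Implicit.
Unset Printing Implicit Defensive.

Import Order.TTheory GRing.Theory Num.Theory numFieldNormedType.Exports.

Local Open Scope classical_set_scope.
Local Open Scope ring_scope.

(* Smooth manifolds are presented by an atlas, and tensor fields by their
   components in every chart together with the tensor transformation law.
   Components are functions of the point of M; their values outside the domain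
   of the chart are never used.  Pointwise conditions on tensors are required
   in every chart containing the point.  Tangent vectors are row vectors, so
   linear maps act on the right. *)

(* C^k and C^oo real functions on an open subset V of R^n. *)
Fixpoint Ck_on (R : realType) (n k : nat) (V : set 'rV[R]_n)
    (f : 'rV[R]_n -> R) : Prop :=
  match k with
  | 0 => forall x, V x -> {for x, continuous f}
  | k'.+1 => (forall x, V x -> differentiable f x) /\
             (forall a : 'I_n, Ck_on k' V (fun x => 'D_(delta_mx 0 a) f x))
  end.

Definition smooth_on (R : realType) (n : nat) (V : set 'rV[R]_n)
    (f : 'rV[R]_n -> R) : Prop := forall k, Ck_on k V f.

Record manifold (R : realType) (n : nat) := Manifold {
  points :> topologicalType;
  points_hausdorff : hausdorff_space points;
  points_second_countable : @second_countable points;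
  chart : Type;
  dom : chart -> set points;
  coord : chart -> points -> 'rV[R]_n;
  param : chart -> 'rV[R]_n -> points;  (* inverse of [coord] *)
  dom_open : forall i, open (dom i);
  dom_cover : forall p, exists i, dom i p;
  coord_open : forall i, open (coord i @` dom i);
  coordK : forall i p, dom i p -> param i (coord i p) = p;
  coord_continuous : forall i p, dom i p -> {for p, continuous (coord i)};
  param_continuous :
    forall i p, dom i p -> {for coord i p, continuous (param i)};
  transition_smooth : forall i j (a : 'I_n),
    smooth_on (coord i @` (dom i `&` dom j))
      (fun x => coord j (param i x) 0 a)
}.

Section Manifold.
Variables (R : realType) (n : nat) (M : manifold R n).

Definition smooth_in (i : chart M) (V : set M) (f : M -> R) : Prop :=
  smooth_on (coord i @` V) (f \o param i).

Definition pd (i : chart M) (a : 'I_n) (f : M -> R) (p : M) : R :=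
  'D_(delta_mx 0 a) (f \o param i) (coord i p).

(* Entry (a, b) is the derivative of the b-th coordinate of chart j with
   respect to the a-th coordinate of chart i. *)
Definition jac (i j : chart M) (p : M) : 'M[R]_n :=
  \matrix_(a, b) pd i a (fun q => coord j q 0 b) p.

Definition ip (G : 'M[R]_n) (u v : 'rV[R]_n) : R := (u *m G *m v^T) 0 0.

Definition minkowski : 'M[R]_n :=
  diag_mx (\row_(a < n) if val a == 0%N then -1 else 1).

Record lorentz_metric := LorentzMetric {
  gm : chart M -> M -> 'M[R]_n;
  gm_smooth : forall i a b, smooth_in i (dom i) (fun p => gm i p a b);
  gm_sym : forall i p, dom i p -> (gm i p)^T = gm i p;
  gm_lorentz : forall i p, dom i p ->
    exists2 P : 'M[R]_n, P \in unitmx & P *m gm i p *m P^T = minkowski;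
  gm_tensor : forall i j p, dom i p -> dom j p ->
    gm i p = jac i j p *m gm j p *m (jac i j p)^T
}.

(* The last field says that the lines form a smooth subbundle of TM. *)
Record null_congruence (g : lorentz_metric) := NullCongruence {
  line : chart M -> M -> {vspace 'rV[R]_n};
  line_dim : forall i p, dom i p -> \dim (line i p) = 1%N;
  line_null : forall i p v, dom i p -> v \in line i p -> ip (gm g i p) v v = 0;
  line_vector : forall i j p v, dom i p -> dom j p ->
    (v \in line i p) = (v *m jac i j p \in line j p);
  line_smooth : forall i p, dom i p ->
    exists (V : set M) (k : M -> 'rV[R]_n),
      [/\ open V, V p, V `<=` dom i,
          forall a, smooth_in i V (fun q => k q 0 a)
        & forall q, V q -> line i q = <[k q]>%VS]
}.

Section LeviCivita.
Variables (g : lorentz_metric) (i : chart M).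

Definition ginv (p : M) : 'M[R]_n := invmx (gm g i p).

(* [christoffel c a b] is Gamma^c_{ab}. *)
Definition christoffel (c a b : 'I_n) (p : M) : R :=
  2^-1 * \sum_d ginv p c d *
    (pd i a (fun q => gm g i q b d) p + pd i b (fun q => gm g i q a d) p
     - pd i d (fun q => gm g i q a b) p).

(* [riemann a b c d] is R^a_{bcd}, with
   (nabla_c nabla_d - nabla_d nabla_c) v^a = R^a_{bcd} v^b. *)
Definition riemann (a b c d : 'I_n) (p : M) : R :=
  pd i c (christoffel a d b) p - pd i d (christoffel a c b) p
  + \sum_e (christoffel a c e p * christoffel e d b p
            - christoffel a d e p * christoffel e c b p).

Definition ricci (p : M) : 'M[R]_n :=
  \matrix_(b, d) \sum_a riemann a b a d p.

Definition scalar_curvature (p : M) : R :=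
  \sum_a \sum_b ginv p a b * ricci p a b.

Definition tracefree_ricci (p : M) : 'M[R]_n :=
  ricci p - (scalar_curvature p / n%:R) *: gm g i p.

(* [nabla_cov2 T p c a b] is nabla_c T_{ab}. *)
Definition nabla_cov2 (T : M -> 'M[R]_n) (p : M) (c a b : 'I_n) : R :=
  pd i c (fun q => T q a b) p
  - \sum_d (christoffel d c a p * T p d b + christoffel d c b p * T p a d).

(* The vector X^a nabla_a k^b. *)
Definition nabla_vec (k : M -> 'rV[R]_n) (p : M) (X : 'rV[R]_n) : 'rV[R]_n :=
  \row_b \sum_a X 0 a *
    (pd i a (fun q => k q 0 b) p + \sum_c christoffel b a c p * k p 0 c).

(* S and nabla S as multilinear forms on the tangent space at p. *)
Definition S_form (p : M) (v : 2.-tuple 'rV[R]_n) : R :=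
  \sum_a \sum_b v`_0 0 a * v`_1 0 b * tracefree_ricci p a b.

Definition nablaS_form (p : M) (v : 3.-tuple 'rV[R]_n) : R :=
  \sum_c \sum_a \sum_b v`_0 0 c * v`_1 0 a * v`_2 0 b *
    nabla_cov2 tracefree_ricci p c a b.

(* Entry (b, a) is S^a_b, so that [v *m S_endo p] is the vector S^a_b v^b. *)
Definition S_endo (p : M) : 'M[R]_n := tracefree_ricci p *m ginv p.

End LeviCivita.

(* Null frames e_0 = k, e_1 = l, e_i = m_i of a Lorentzian inner product G,
   with k spanning the null line c. *)
Definition null_frame (G : 'M[R]_n) (c : {vspace 'rV[R]_n})
    (e : 'I_n -> 'rV[R]_n) : Prop :=
  (forall a : 'I_n, val a = 0%N -> e a \in c /\ e a != 0) /\
  (forall a b : 'I_n, ip G (e a) (e b) =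
     [|| (val a == 0%N) && (val b == 1%N), (val a == 1%N) && (val b == 0%N)
       | (2 <= val a)%N && (a == b)]%:R).

Definition boost_weight (r : nat) (al : r.-tuple 'I_n) : int :=
  (count (fun a : 'I_n => val a == 0%N) al)%:Z
  - (count (fun a : 'I_n => val a == 1%N) al)%:Z.

(* bo_c(T) <= s; the zero tensor satisfies this for every s.  The boost order
   does not depend on the null frame. *)
Definition boost_order_le (G : 'M[R]_n) (c : {vspace 'rV[R]_n}) (r : nat)
    (T : r.-tuple 'rV[R]_n -> R) (s : int) : Prop :=
  forall e, null_frame G c e ->
  forall al : r.-tuple 'I_n, T (map_tuple e al) != 0 -> boost_weight al <= s.

Section Congruence.
Variables (g : lorentz_metric) (c : null_congruence g).

Definition bo_S_le (s : int) : Prop := forall i p, dom i p ->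
  boost_order_le (gm g i p) (line c i p) (S_form g i p) s.

Definition bo_nablaS_le (s : int) : Prop := forall i p, dom i p ->
  boost_order_le (gm g i p) (line c i p) (nablaS_form g i p) s.

(* The generalized eigenspace E_lambda of S at p, for the eigenvalue lambda of
   S on the line c, has dimension 2. *)
Definition generic_type_II (p : M) : Prop := forall i, dom i p ->
  exists lambda : R,
    (forall k, k \in line c i p -> k *m S_endo g i p = lambda *: k) /\
    \rank (geigenspace (S_endo g i p) lambda) = 2%N.

(* Smooth non-vanishing sections of c over the open set V. *)
Definition nonvanishing_section (V : set M)
    (k : chart M -> M -> 'rV[R]_n) : Prop :=
  [/\ forall i p, V p -> dom i p -> k i p \in line c i p /\ k i p != 0,
      forall i j p, V p -> dom i p -> dom j p -> k j p = k i p *m jac i j p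
    & forall i a, smooth_in i (V `&` dom i) (fun p => k i p 0 a)].

Definition kundt (U : set M) : Prop :=
  forall (V : set M) (k : chart M -> M -> 'rV[R]_n),
    open V -> V `<=` U -> nonvanishing_section V k ->
  forall i p, V p -> dom i p ->
  forall X : 'rV[R]_n,
    (forall w, w \in line c i p -> ip (gm g i p) X w = 0) ->
  exists mu : R, nabla_vec g i (k i) p X = mu *: k i p.

End Congruence.
End Manifold.

(* Main.v *)
From HB Require Import structures.
From mathcomp Require Import all_boot all_order all_algebra perm.
From mathcomp Require Import all_classical all_reals all_analysis.
From mathcomp Require Import ring lra.
Require Import Defs.

(** Let [k] be a local section of [c], [lam] the eigenvalue of [S] on [k], and
    [X], [Y] vectors orthogonal to [k].  In a null frame adapted to [k] the
    components of [nabla S] of the form (X, k, Y) have positive boost weight,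
    so [(nabla_X S)(k, Y) = 0].  Differentiating the eigenvalue equation in the
    direction [X] then gives [(S - lam) (nabla_X k)] orthogonal to [k^perp],
    that is, proportional to [k].  Also [nabla_X k] is orthogonal to [k],
    because [k] is null.  The point is now algebraic: when the generalized
    eigenspace [E_lam] is two-dimensional, the only vectors [v] of [k^perp] with
    [(S - lam) v] proportional to [k] are the multiples of [k] ([isolated]).
    Such a [v] lies in [E_lam]; if it were independent of [k], the plane
    [E_lam] would be spanned by [k] and [v] and hence be orthogonal to its own
    vector [k], whereas a generalized eigenspace of a self-adjoint operator is
    nondegenerate ([geigen_plane_null]).  Hence [nabla_X k] is proportional to
    [k].

    The hypothesis on [E_lam] is made at [p] only.  Isolation of [k] is
    equivalent to the invertibility of a matrix depending polynomially on [S],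
    the metric and [k] ([isolated_bordered], [bordered_isolated]), so it
    persists near [p] ([isolated_near]).

    All of this takes place in one chart, while the Kundt condition is required
    in every chart.  Neither curvature nor generic type has to be transported:
    it suffices that [g(nabla_X k, Y)] does not depend on the chart
    ([nabla_vec_chain]), which follows from the Koszul formula and the symmetry
    of the second derivatives of the transition functions.

    Self-adjointness of [S] needs the symmetry of the Ricci tensor
    ([ricci_sym]).  From the coordinate formula this is the symmetry in [b] and
    [d] of the derivative of the contracted Christoffel symbols, which are half
    the trace of [g^-1 (d_b g)].

    Schwarz's theorem ([derive_comm]) is used for the metric and for the
    transition functions; the null frames needed to read the boost order
    hypotheses are obtained from a standard frame of Minkowski space by one
    reflection ([null_frame_exists]). *)

Set Implicit Arguments.
Unset Strict Implicit.
Unset Printing Implicit Defensive.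

Import Order.TTheory GRing.Theory Num.Theory numFieldNormedType.Exports.

Local Open Scope classical_set_scope.
Local Open Scope ring_scope.

(** * Inner products given by matrices *)

Section Ip.
Variables (R : realType) (n : nat).
Implicit Types (A B G : 'M[R]_n) (r u v w k l : 'rV[R]_n).

Lemma ipDl G u v w : ip G (u + v) w = ip G u w + ip G v w.
Proof. by rewrite /ip !mulmxDl mxE. Qed.

Lemma ipDr G u v w : ip G u (v + w) = ip G u v + ip G u w.
Proof. by rewrite /ip linearD /= mulmxDr mxE. Qed.

Lemma ipZl G a u v : ip G (a *: u) v = a * ip G u v.
Proof. by rewrite /ip -!scalemxAl mxE. Qed.

Lemma ipZr G a u v : ip G u (a *: v) = a * ip G u v.
Proof. by rewrite /ip linearZ /= -!scalemxAr mxE. Qed.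

Lemma ip0r G u : ip G u 0 = 0.
Proof. by rewrite /ip trmx0 mulmx0 mxE. Qed.

Lemma ip_suml G m (x : 'I_m -> R) (e : 'I_m -> 'rV[R]_n) v :
  ip G (\sum_a x a *: e a) v = \sum_a x a * ip G (e a) v.
Proof.
rewrite /ip mulmx_suml mulmx_suml summxE; apply: eq_bigr => a _.
by rewrite -!scalemxAl mxE.
Qed.

Lemma ip_sumr G m (x : 'I_m -> R) (e : 'I_m -> 'rV[R]_n) u :
  ip G u (\sum_a x a *: e a) = \sum_a x a * ip G u (e a).
Proof.
rewrite /ip linear_sum /= mulmx_sumr summxE; apply: eq_bigr => a _.
by rewrite linearZ /= -!scalemxAr mxE.
Qed.

Lemma ipC G u v : G^T = G -> ip G u v = ip G v u.
Proof.
move=> sG; rewrite /ip; transitivity ((u *m G *m v^T)^T 0 0).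
  by rewrite [RHS]mxE.
by rewrite !trmx_mul trmxK sG mulmxA.
Qed.

Lemma ipMl G (P : 'M[R]_n) u v : ip G (u *m P) v = ip (P *m G) u v.
Proof. by rewrite /ip !mulmxA. Qed.

Lemma ip_mx1 G u v : (u *m G *m v^T) = (ip G u v)%:M.
Proof. by rewrite [LHS]mx11_scalar. Qed.

Lemma ipE G u v : ip G u v = \sum_a \sum_b u 0 a * v 0 b * G a b.
Proof.
rewrite /ip mxE exchange_big /=; apply: eq_bigr => b _.
rewrite !mxE mulr_suml; apply: eq_bigr => a _.
by rewrite mulrAC.
Qed.

Lemma ip_eq0P G u : G \in unitmx -> (forall v, ip G u v = 0) -> u = 0.
Proof.
move=> uG h; suff: u *m G = 0 by move/(congr1 (mulmx^~ (invmx G))); rewrite mulmxK // mul0mx.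
apply/rowP => b; have := h (delta_mx 0 b); rewrite /ip trmx_delta.
by rewrite -colE !mxE.
Qed.

Lemma ip_delta A u (d : 'I_n) : ip A u (delta_mx 0 d) = \sum_c u 0 c * A c d.
Proof. by rewrite /ip trmx_delta -colE !mxE. Qed.

Lemma ip_sum_delta A u v : \sum_d ip A u (delta_mx 0 d) * v 0 d = ip A u v.
Proof.
rewrite [v in RHS]row_sum_delta ip_sumr.
by apply: eq_bigr => d _; rewrite mulrC.
Qed.

Lemma ip_mx_sum m (x : 'I_m -> R) (A : 'I_m -> 'M[R]_n) u v :
  ip (\sum_c x c *: A c) u v = \sum_c x c * ip (A c) u v.
Proof.
rewrite /ip mulmx_sumr mulmx_suml summxE; apply: eq_bigr => c _.
by rewrite -scalemxAr -scalemxAl mxE.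
Qed.

Lemma ip_dot A u v : ip A u v = ip 1%:M (u *m A) v.
Proof. by rewrite /ip mulmx1. Qed.

Lemma ip1_inj r w : (forall v, ip 1%:M r v = ip 1%:M w v) -> r = w.
Proof.
move=> h; apply/eqP; rewrite -subr_eq0; apply/eqP.
apply: (@ip_eq0P 1%:M); first exact: unitmx1.
by move=> v; rewrite -scaleN1r ipDl ipZl h mulN1r subrr.
Qed.

(** Turns orthogonality to a hyperplane into proportionality: it yields the
    eigenvalue of [S] on [k] from [S(k, .)] vanishing on [k^perp]. *)
Lemma annihilator r w l : ip 1%:M w l != 0 ->
  (forall v, ip 1%:M w v = 0 -> ip 1%:M r v = 0) ->
  r = (ip 1%:M r l / ip 1%:M w l) *: w.
Proof.
move=> wl h; apply: ip1_inj => v; rewrite ipZl.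
have := h (v - (ip 1%:M w v / ip 1%:M w l) *: l).
rewrite -!(scaleNr _ l) !(ipDr, ipZr) mulNr divfK // subrr => /(_ erefl) e.
by rewrite -[LHS]subr0 -e; field.
Qed.

Lemma ip_neq0 G k : G \in unitmx -> k != 0 -> exists l, ip G k l != 0.
Proof.
move=> uG k0; apply: contrapT => /forallNP no.
move/eqP: k0; apply; apply: (ip_eq0P uG) => v.
by apply/eqP; apply: contrapT => /negP; apply: no.
Qed.

Lemma ip_mulmx G (P Q : 'M[R]_n) u v :
  ip (P *m G *m Q^T) u v = ip G (u *m P) (v *m Q).
Proof. by rewrite /ip trmx_mul !mulmxA. Qed.

Lemma ipDm A B u v : ip (A + B) u v = ip A u v + ip B u v.
Proof. by rewrite /ip mulmxDr mulmxDl mxE. Qed.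

End Ip.

(** * Isolated eigenlines *)

Section Fitting.
Variables (F : fieldType) (n : nat).
Implicit Types A G : 'M[F]_n.+1.

(** Write the characteristic polynomial of [A] as [q * 'X^m] with [q] not
    vanishing at 0.  By Cayley-Hamilton [w A^(n+1)] is killed by [q(A)]; if it
    is also killed by [A], it vanishes since [q] and ['X] are coprime. *)
Lemma ker_expr_stable A (w : 'rV[F]_n.+1) :
  w *m A ^+ n.+2 = 0 -> w *m A ^+ n.+1 = 0.
Proof.
move=> wA; set w' := w *m A ^+ n.+1.
have w'A : w' *m A = 0 by rewrite -mulmxA -[A ^+ n.+1 *m A]exprSr.
have [q [m pE]] : exists q m, ~~ root q 0 /\ char_poly A = q * 'X^m.
  have [m [q /implyP h pE]] := multiplicity_XsubC (char_poly A) 0.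
  exists q, m; split; first by apply: h; rewrite monic_neq0 ?char_poly_monic.
  by rewrite pE subr0.
case: pE => rq pE.
have q0 : q != 0 by apply: contraNneq rq => ->; rewrite root0.
have mn : (m <= n.+1)%N.
  have := size_char_poly A; rewrite pE size_mulXn // => e.
  have : (0 < size q)%N by rewrite size_poly_gt0.
  by rewrite -(leq_add2l m) e addn1 ltnS.
have w'q : w' *m horner_mx A q = 0.
  have := Cayley_Hamilton A; rewrite pE rmorphM rmorphXn /= horner_mx_X => h.
  have c : horner_mx A q * A ^+ m = A ^+ m * horner_mx A q.
    by rewrite -[A in A ^+ m]horner_mx_X -rmorphXn /= -!rmorphM /= mulrC.
  have mE : A ^+ n.+1 = A ^+ (n.+1 - m) *m A ^+ m.
    by rewrite -[RHS]exprD subnK.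
  rewrite /w' mE -!mulmxA -[X in _ *m (_ *m X)]c.
  by rewrite [horner_mx A q * A ^+ m]h !mulmx0.
have : (w' <= kermxpoly A 'X :&: kermxpoly A q)%MS.
  rewrite sub_capmx; apply/andP; split; apply/sub_kermxP => //.
  by rewrite horner_mx_X.
rewrite mxdirect_kermxpoly; first by move/submx0null.
by rewrite coprimep_sym -['X]subr0 -polyC0 coprimep_XsubC.
Qed.

(** If [v] were independent of [k], the two would span the generalized kernel
    [E] of [A], and [k] would be orthogonal to [E].  As [A] is self-adjoint, the
    orthogonal complement of [E] is the image of [A^(n+1)]; so [k] would be
    both [w A^(n+1)] and in the kernel of [A], against [ker_expr_stable]. *)
Lemma geigen_plane_null A G (k v : 'rV[F]_n.+1) (s : F) :
  G \in unitmx -> G^T = G -> (A *m G)^T = A *m G ->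
  k != 0 -> k *m A = 0 -> k *m G *m k^T = 0 ->
  \rank (kermx (A ^+ n.+1)) = 2%N ->
  v *m G *m k^T = 0 -> v *m A = s *: k -> (v <= k)%MS.
Proof.
move=> uG sG sA k0 kA kk rE vk vA; apply: contraT => nvk.
have kE : (k <= kermx (A ^+ n.+1))%MS.
  by apply/sub_kermxP; rewrite exprS mulmxA kA mul0mx.
have n0 : (0 < n)%N.
  by have := rank_leq_row (kermx (A ^+ n.+1)); rewrite rE.
have vE : (v <= kermx (A ^+ n.+1))%MS.
  have AE : A ^+ n.+1 = A *m (A *m A ^+ n.-1).
    by rewrite -[A *m A ^+ _]exprS prednK // -[RHS]exprS.
  apply/sub_kermxP; rewrite AE !mulmxA vA -!scalemxAl kA.
  by rewrite mul0mx scaler0.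
have kvE : (col_mx k v <= kermx (A ^+ n.+1))%MS by rewrite col_mx_sub kE.
have rkv : (2 <= \rank (col_mx k v))%N.
  rewrite ltnNge; apply: contra nvk => le1.
  have kkv : (k <= col_mx k v)%MS by rewrite -addsmxE addsmxSl.
  have vkv : (v <= col_mx k v)%MS by rewrite -addsmxE addsmxSr.
  apply: submx_trans vkv _; rewrite -(geq_leqif (mxrank_leqif_sup kkv)).
  by rewrite rank_rV k0.
have Ekv : (kermx (A ^+ n.+1) <= col_mx k v)%MS.
  by rewrite -(geq_leqif (mxrank_leqif_sup kvE)) rE.
have Ek u : u *m A ^+ n.+1 = 0 -> u *m G *m k^T = 0.
  move/sub_kermxP => uE; have /submxP[D ->] := submx_trans uE Ekv.
  by rewrite -!mulmxA mul_col_mx [k *m _]mulmxA [v *m _]mulmxA kk vk col_mx0 mulmx0.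
have sAm m : (A ^+ m *m G)^T = A ^+ m *m G.
  elim: m => [|m IH]; first by rewrite expr0 mul1mx.
  have e : G *m (A ^+ m)^T = A ^+ m *m G by rewrite -IH trmx_mul sG.
  have AS : A ^+ m.+1 *m G = A ^+ m *m (A *m G) by rewrite mulmxA exprSr.
  rewrite {1}AS trmx_mul sA -mulmxA e mulmxA.
  by rewrite [A *m _](_ : _ = A ^+ m.+1) // exprS.
(* Orthogonality to the kernel of a symmetric matrix means lying in its row space. *)
have kB : (k *m G <= A ^+ n.+1 *m G)%MS.
  set B := A ^+ n.+1 *m G.
  rewrite submxE; apply/eqP.
  have cB : (cokermx B)^T *m A ^+ n.+1 = 0.
    have : (B *m cokermx B)^T = 0 by rewrite mulmx_coker trmx0.
    rewrite trmx_mul sAm mulmxA => /(congr1 (mulmx^~ (invmx G))).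
    by rewrite mulmxK // mul0mx.
  apply: trmx_inj; rewrite trmx0 trmx_mul [(k *m G)^T]trmx_mul sG mulmxA.
  apply/row_matrixP => i; rewrite !row_mul row0; apply: Ek.
  by rewrite -row_mul cB row0.
have /submxP[w /(congr1 (mulmx^~ (invmx G)))] := kB.
rewrite mulmxA !mulmxK // => kw.
have : w *m A ^+ n.+2 = 0 by rewrite exprSr mulmxA -kw.
by move/ker_expr_stable; rewrite -kw => /eqP; rewrite (negPf k0).
Qed.

End Fitting.

Section Isolated.
Variables (R : realType) (n : nat).
Implicit Types (S G : 'M[R]_n) (k l v : 'rV[R]_n).

(** The consequence of [E_lam] being a plane that the argument uses.  Unlike the
    dimension of a generalized eigenspace, it is easily recast as an open
    condition on [S], [G] and [k], see [bordered]. *)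
Definition isolated S G k := forall lam v s, k *m S = lam *: (k *m G) ->
  ip G v k = 0 -> v *m S - lam *: (v *m G) = s *: (k *m G) -> (v <= k)%MS.

(** When [k] is an eigenvector, the first two terms are [G(k, l)] times
    [S - lam G], without the division by [G(k, l)] in
    [lam = S(k, l) / G(k, l)].  They have [k] in their kernel.  Adding the symmetric
    product of the covectors of [k] and [l] removes [k] from it, and what is
    left of the kernel measures the failure of isolation. *)
Definition bordered S G k l : 'M[R]_n :=
  ip G k l *: S - ip S k l *: G
  + ((k *m G)^T *m (l *m G) + (l *m G)^T *m (k *m G)).

Lemma isolated_scale S G k a : a != 0 -> isolated S G k -> isolated S G (a *: k).
Proof.
move=> a0 iso lam v s ks vk vs.
rewrite (eqmx_scale _ a0); apply: (iso lam v (s * a)).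
- apply: (scalerI a0); rewrite scalerA [a * lam]mulrC -scalerA.
  by rewrite scalemxAl ks -scalemxAl.
- by move/eqP: vk; rewrite ipZr mulf_eq0 (negPf a0) => /eqP.
- by rewrite vs -scalemxAl scalerA.
Qed.

Lemma borderedE S G k l a b : bordered S G k l a b =
  ip G k l * S a b + - (ip S k l * G a b)
  + ((k *m G) 0 a * (l *m G) 0 b + (l *m G) 0 a * (k *m G) 0 b).
Proof.
rewrite /bordered; move: (k *m G) (l *m G) => P Q.
by rewrite !mxE !big_ord1 !mxE.
Qed.

Variables (S G : 'M[R]_n) (k l : 'rV[R]_n) (lam : R).
Hypotheses (sS : S^T = S) (sG : G^T = G) (kl : ip G k l != 0).
Hypothesis kS : k *m S = lam *: (k *m G).

Let Skl : ip S k l = lam * ip G k l.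
Proof. by rewrite /ip kS -scalemxAl mxE. Qed.

Lemma mul_bordered v : v *m bordered S G k l =
  ip G k l *: (v *m S - lam *: (v *m G))
  + (ip G v k *: (l *m G) + ip G v l *: (k *m G)).
Proof.
rewrite /bordered mulmxDr mulmxBr mulmxDr !mulmxA !trmx_mul sG !mulmxA.
rewrite !ip_mx1 !mul_scalar_mx -!scalemxAr Skl scalerBr scalerA.
by rewrite [lam * _]mulrC -!scalemxAl.
Qed.

Let lam_uniq mu : k *m S = mu *: (k *m G) -> mu = lam.
Proof.
move=> h; have : ip S k l = mu * ip G k l by rewrite /ip h -scalemxAl mxE.
by rewrite Skl => /(mulIf kl).
Qed.

(** Let [v] be in the kernel.  Pairing with [k] leaves [G(v, k) G(k, l) = 0], so
    [v] is orthogonal to [k] and [(S - lam G) v] is proportional to [k]; isolation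
    gives [v = a k], and what remains of the equation is [a G(k, l) k = 0]. *)
Lemma isolated_bordered : ip G k k = 0 ->
  isolated S G k -> bordered S G k l \in unitmx.
Proof.
move=> kk iso; rewrite -row_free_unit -kermx_eq0; apply/rowV0P => v.
move=> /sub_kermxP; rewrite mul_bordered => vQ.
have vk : ip G v k = 0.
  have := congr1 (fun u : 'rV_n => (u *m k^T) 0 0) vQ.
  rewrite mul0mx !mulmxDl -!scalemxAl mulmxBl -!scalemxAl.
  have -> : v *m S *m k^T = lam *: (v *m G *m k^T).
    rewrite !ip_mx1 (ipC _ _ sS) (ipC _ _ sG) scale_scalar_mx.
    by rewrite [ip S k v]/ip kS -scalemxAl mxE.
  rewrite subrr scaler0 add0r !ip_mx1 kk !mxE /= !mulr1n mulr0 addr0.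
  rewrite (ipC l k sG) => /eqP.
  by rewrite mulf_eq0 (negPf kl) orbF => /eqP.
rewrite vk scale0r add0r in vQ.
have vS : v *m S - lam *: (v *m G) = - (ip G v l / ip G k l) *: (k *m G).
  apply: (scalerI kl); rewrite scalerA mulrN mulrCA divff // mulr1 scaleNr.
  by apply/eqP; rewrite -addr_eq0 vQ.
have /sub_rVP[a va] := iso _ _ _ kS vk vS.
have : lam *: (v *m G) = v *m S by rewrite va -!scalemxAl kS !scalerA mulrC.
move=> e; rewrite -e subrr scaler0 add0r in vQ.
have := congr1 (fun u : 'rV_n => (u *m l^T) 0 0) vQ.
rewrite mul0mx -scalemxAl ip_mx1 !mxE /= mulr1n => /eqP.
rewrite mulf_eq0 (negPf kl) orbF va ipZl mulf_eq0 (negPf kl) orbF => /eqP ->.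
by rewrite scale0r.
Qed.

(** A vector [v] violating isolation can be corrected by a multiple of [k], which
    does not change [(S - lam G) v], so as to be annihilated by the bordered
    matrix. *)
Lemma bordered_isolated : ip G k k = 0 ->
  bordered S G k l \in unitmx -> isolated S G k.
Proof.
move=> kk uQ mu v s kmu vk; rewrite (lam_uniq kmu) => vS.
pose a := (ip G v l + s * ip G k l) / ip G k l.
suff : (v - a *: k) *m bordered S G k l = 0.
  move/(congr1 (mulmx^~ (invmx (bordered S G k l)))); rewrite mulmxK // mul0mx.
  by move/eqP; rewrite subr_eq0 => /eqP ->; rewrite scalemx_sub.
rewrite mulmxBl -scalemxAl !mul_bordered vk kk vS kS subrr scaler0.
rewrite !scale0r !add0r !scalerA -scalerDl -scalerBl.
suff -> : ip G k l * s + ip G v l - a * ip G k l = 0 by rewrite scale0r.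
by rewrite /a; field.
Qed.

End Isolated.

(** Apply [geigen_plane_null] to [A = S G^-1 - lam], for which [A G] is
    symmetric. *)
Lemma isolated_of_rank (R : realType) n (S G : 'M[R]_n) (k : 'rV[R]_n) lam :
  (0 < n)%N ->
  G \in unitmx -> G^T = G -> S^T = S -> k != 0 -> ip G k k = 0 ->
  k *m S = lam *: (k *m G) ->
  \rank (geigenspace (S *m invmx G) lam) = 2%N -> isolated S G k.
Proof.
case: n S G k => // m S G k _ uG sG sS k0 kk kS rk mu v s kmu vk vs.
have [l kl] := ip_neq0 uG k0.
have lm : mu = lam.
  apply: (mulIf kl); transitivity (ip S k l).
    by rewrite [RHS]ip_dot kmu ipZl -ip_dot.
  by rewrite [LHS]ip_dot kS ipZl -ip_dot.
pose A := S *m invmx G - lam%:M.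
have AG : A *m G = S - lam *: G.
  by rewrite mulmxBl mulmxKV // mul_scalar_mx.
have vA (u : 'rV_m.+1) : u *m A = (u *m S - lam *: (u *m G)) *m invmx G.
  by rewrite mulmxBl -scalemxAl mulmxK // mulmxBr mulmxA mul_mx_scalar.
apply: (@geigen_plane_null _ _ A G k v s) => //.
- by rewrite AG linearB linearZ /= sS sG.
- by rewrite vA kS subrr mul0mx.
- by rewrite ip_mx1 kk raddf0.
- by rewrite -geigenspaceE.
- by rewrite ip_mx1 vk raddf0.
- by rewrite vA -lm vs -scalemxAl mulmxK.
Qed.

Section Eigen.
Variables (R : realType) (n : nat).

Lemma eigen_of_orth (S G : 'M[R]_n) (k l : 'rV[R]_n) : ip G k l != 0 ->
  (forall v, ip G k v = 0 -> ip S k v = 0) ->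
  exists lam, k *m S = lam *: (k *m G).
Proof.
move=> kl h; exists (ip 1%:M (k *m S) l / ip 1%:M (k *m G) l).
apply: annihilator; first by rewrite -ip_dot.
by move=> v; rewrite -!ip_dot; apply: h.
Qed.

(** The algebraic end of the argument, for [w = nabla_X k]. *)
Lemma isolated_multiple (S G : 'M[R]_n) (k l w : 'rV[R]_n) lam :
  G^T = G -> ip G k l != 0 ->
  isolated S G k -> k *m S = lam *: (k *m G) -> ip G w k = 0 ->
  (forall v, ip G k v = 0 -> ip S w v = lam * ip G w v) ->
  exists mu, w = mu *: k.
Proof.
move=> sG kl iso kS wk h.
have e : w *m S - lam *: (w *m G) =
    (ip 1%:M (w *m S - lam *: (w *m G)) l / ip 1%:M (k *m G) l) *: (k *m G).
  apply: annihilator; first by rewrite -ip_dot.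
  move=> v; rewrite -ip_dot => kv.
  by rewrite -scaleNr ipDl ipZl -!ip_dot h // mulNr subrr.
by have /sub_rVP[mu ->] := iso _ _ _ kS wk e; exists mu.
Qed.

End Eigen.

(** * Null frames *)

Section NullFrame.
Variables (R : realType) (n : nat) (hn : (2 <= n)%N).

Let i0 : 'I_n := Ordinal (ltnW hn).
Let i1 : 'I_n := Ordinal hn.

Definition null_gram (a b : 'I_n) : bool :=
 [|| (val a == 0%N) && (val b == 1%N), (val a == 1%N) && (val b == 0%N)
       | (2 <= val a)%N && (a == b)].

Lemma minkowski_sym : (minkowski R n)^T = minkowski R n.
Proof. by rewrite /minkowski tr_diag_mx. Qed.

Lemma ip_minkowski (u v : 'rV[R]_n) :
  ip (minkowski R n) u v =
  \sum_a (if val a == 0%N then -1 else 1) * (u 0 a * v 0 a).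
Proof.
rewrite /ip /minkowski mul_mx_diag !mxE; apply: eq_bigr => a _.
by rewrite !mxE mulrAC mulrC.
Qed.

Lemma ip_minkowskil (a : 'I_n) (v : 'rV[R]_n) :
  ip (minkowski R n) (delta_mx 0 a) v = (if val a == 0%N then -1 else 1) * v 0 a.
Proof.
rewrite ip_minkowski (bigD1 a) //= big1 ?addr0 => [|b /negPf ba].
  by rewrite !mxE !eqxx /= mul1r.
by rewrite !mxE ba andbF mul0r mulr0.
Qed.

Lemma delta_rowE (a b : 'I_n) : (delta_mx 0 a : 'rV[R]_n) 0 b = (b == a)%:R.
Proof. by rewrite mxE eqxx. Qed.

(** For [eps = 1] and [eps = -1] these are two null frames of Minkowski space,
    whose first vectors span different null lines. *)
Definition std_frame (eps : R) (a : 'I_n) : 'rV[R]_n :=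
  if val a == 0%N then delta_mx 0 i0 + eps *: delta_mx 0 i1
  else if val a == 1%N then
    2^-1 *: ((-1) *: delta_mx 0 i0 + eps *: delta_mx 0 i1)
  else delta_mx 0 a.

Lemma ord_cases (a : 'I_n) : [\/ a = i0, a = i1 | (2 <= val a)%N].
Proof.
case: (ltngtP (val a) 1) => [|lt1|a1]; last by apply: Or32; apply: val_inj.
- by rewrite ltnS leqn0 => /eqP a0; apply: Or31; apply: val_inj.
- exact: Or33.
Qed.

Lemma std_frame_null_gram (eps : R) (a b : 'I_n) : eps * eps = 1 ->
  ip (minkowski R n) (std_frame eps a) (std_frame eps b) = (null_gram a b)%:R.
Proof.
move=> ee.
have gt2 (x : 'I_n) : (2 <= val x)%N ->
  [/\ (val x == 0%N) = false, (val x == 1%N) = false,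
      ((x == i0) = false) * ((i0 == x) = false)
    & ((x == i1) = false) * ((i1 == x) = false)].
  by case: x => [[|[|x]] hx].
have i10 : (i1 == i0) = false by [].
have i01 : (i0 == i1) = false by [].
have dd (x y : 'I_n) : ip (minkowski R n) (delta_mx 0 x) (delta_mx 0 y) =
    (if val x == 0%N then -1 else 1) * (y == x)%:R.
  by rewrite ip_minkowskil delta_rowE [x == y]eq_sym.
rewrite /std_frame; move: dd; move: (minkowski R n) (@delta_mx R 1 n 0) => G d dd.
case: (ord_cases a) => [->|->|/[dup] a2 /gt2[a2a a2b [a20 a20'] [a21 a21']]];
case: (ord_cases b) => [->|->|/[dup] b2 /gt2[b2a b2b [b20 b20'] [b21 b21']]];
rewrite /null_gram /= ?a2a ?a2b ?b2a ?b2b ?a2 /=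
  ?(ipDl, ipDr, ipZl, ipZr) ?dd /= ?eqxx ?i10 ?i01
  ?a20 ?a21 ?b20 ?b21 ?a20' ?a21' ?b20' ?b21' ?a2a ?a2b /=.
all: try by rewrite eq_sym mul1r.
all: move: (eps) ee => x ee; nra.
Qed.

(** If [u] were orthogonal to both [e_0 + e_1] and [e_0 - e_1], its components
    along [e_0] and [e_1] would vanish, and [ip u u = 0] would be a vanishing sum
    of squares. *)
Lemma std_frame_nonorth (u : 'rV[R]_n) :
  ip (minkowski R n) u u = 0 -> u != 0 ->
  exists eps, eps * eps = 1 /\
    ip (minkowski R n) u (std_frame eps i0) != 0.
Proof.
move=> uu u0; apply: contrapT => /forallNP no.
have h eps' : eps' * eps' = 1 -> - u 0 i0 + eps' * u 0 i1 = 0.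
  move=> ee; apply/eqP; apply: contrapT => /negP ne; apply: (no eps'); split=> //.
  rewrite (ipC _ _ minkowski_sym) /std_frame /= ipDl ipZl !ip_minkowskil /=.
  by rewrite mulN1r mul1r.
have u00 : u 0 i0 = 0.
  have e1 : (-1 : R) * -1 = 1 by rewrite mulrNN mulr1.
  by have := h 1 (mulr1 1); have := h (-1) e1; lra.
move/eqP: u0; apply; apply/rowP => a; rewrite mxE.
move: uu; rewrite ip_minkowski => /eqP; rewrite psumr_eq0 => [|b _].
  move=> /allP/(_ a); rewrite mem_index_enum => /(_ isT) /=.
  case: ifP => [/eqP a0 _|_].
    by rewrite (_ : a = i0) //; apply: val_inj.
  by rewrite mul1r mulf_eq0 orbb => /eqP.
case: ifP => [/eqP b0|_]; last by rewrite mul1r -expr2 sqr_ge0.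
by rewrite (_ : b = i0) ?u00 ?mul0r ?mulr0 //; apply: val_inj.
Qed.

Definition reflection (G : 'M[R]_n) (w u : 'rV[R]_n) : 'rV[R]_n :=
  u - (2 * ip G u w / ip G w w) *: w.

Lemma ip_reflection (G : 'M[R]_n) (w u v : 'rV[R]_n) : G^T = G -> ip G w w != 0 ->
  ip G (reflection G w u) (reflection G w v) = ip G u v.
Proof.
move=> sG w0; rewrite /reflection -!(scaleNr _ w) !(ipDl, ipDr, ipZl, ipZr).
by rewrite (ipC w v sG); field.
Qed.

(** For null [u] and [v] the vector [v - u] has square [- 2 ip u v], so it is not
    null and the reflection in it exchanges [u] and [v]. *)
Lemma reflection_null (G : 'M[R]_n) (u v : 'rV[R]_n) : G^T = G ->
  ip G u u = 0 -> ip G v v = 0 -> ip G u v != 0 ->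
  ip G (v - u) (v - u) != 0 /\ reflection G (v - u) u = v.
Proof.
move=> sG uu vv uv; have e : ip G (v - u) (v - u) = - 2 * ip G u v.
  rewrite -scaleN1r !(ipDl, ipDr, ipZl, ipZr) uu vv (ipC v u sG); ring.
have e' : ip G u (v - u) = ip G u v.
  by rewrite -scaleN1r !(ipDl, ipDr, ipZl, ipZr) uu; ring.
split; first by rewrite e mulf_neq0 // oppr_eq0 pnatr_eq0.
rewrite /reflection e e'.
have -> : 2 * ip G u v / (- 2 * ip G u v) = -1 by field.
by rewrite scaleN1r opprK addrC subrK.
Qed.

(** After transport to Minkowski space, one of the two standard frames has its
    first vector not orthogonal to [k]; reflect that frame so that its first
    vector becomes [k]. *)
Lemma null_frame_exists (G : 'M[R]_n) (c : {vspace 'rV[R]_n}) (k : 'rV[R]_n) :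
  (exists2 P : 'M[R]_n, P \in unitmx & P *m G *m P^T = minkowski R n) ->
  k \in c -> k != 0 -> ip G k k = 0 ->
  exists2 e, null_frame G c e & e i0 = k.
Proof.
case=> P uP GP kc k0 kk; pose k' := k *m invmx P.
have k'P : k' *m P = k by rewrite mulmxKV.
have ipP u v : ip G (u *m P) (v *m P) = ip (minkowski R n) u v.
  by rewrite -ip_mulmx GP.
have kk' : ip (minkowski R n) k' k' = 0 by rewrite -ipP k'P.
have k'0 : k' != 0 by apply: contraNneq k0 => h; rewrite -k'P h mul0mx.
have [eps [ee ns]] := std_frame_nonorth kk' k'0.
have ss := std_frame_null_gram i0 i0 ee.
rewrite (ipC _ _ minkowski_sym) in ns.
have [w0 rk] := reflection_null minkowski_sym ss kk' ns.
exists (fun a => reflection (minkowski R n) (k' - std_frame eps i0)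
                   (std_frame eps a) *m P); last by rewrite rk.
split=> [a a0|a b].
  by rewrite (_ : a = i0) ?rk ?k'P //; apply: val_inj.
by rewrite ipP (ip_reflection _ _ minkowski_sym w0) std_frame_null_gram.
Qed.

(** The Gram matrix of a null frame is the permutation matrix exchanging 0 and 1:
    the frame is a basis, and the coordinate along [e_1] is the product with
    [e_0]. *)
Lemma null_frame_coord (G : 'M[R]_n) (c : {vspace 'rV[R]_n}) e (v : 'rV[R]_n) :
  null_frame G c e -> ip G v (e i0) = 0 ->
  exists x : 'I_n -> R, v = \sum_a x a *: e a /\ x i1 = 0.
Proof.
case=> _ he ve; pose E : 'M[R]_n := \matrix_a e a.
have EG : E *m G *m E^T = perm_mx (tperm i0 i1).
  apply/matrixP => a b; rewrite !mxE.
  transitivity (ip G (e a) (e b)).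
    rewrite /ip mxE; apply: eq_bigr => j _; rewrite !mxE; congr (_ * _).
    by apply: eq_bigr => i _; rewrite !mxE.
  rewrite he; congr (_%:R); congr (nat_of_bool _).
  rewrite permE /=.
  case: (ord_cases a) => [->|->|]; case: (ord_cases b) => [->|->|] //.
  - by case: b => [[|[|b]] hb].
  - by case: b => [[|[|b]] hb].
  - by case: a => [[|[|a]] ha].
  - by case: a => [[|[|a]] ha].
  - by case: a => [[|[|a]] ha].
have uE : E \in unitmx.
  have : E *m G *m E^T \in unitmx by rewrite EG unitmx_perm.
  by rewrite !unitmx_mul => /andP[/andP[]].
pose y := v *m invmx E.
have vE : v = \sum_a y 0 a *: e a.
  have -> : v = y *m E by rewrite mulmxKV.
  rewrite mulmx_sum_row; apply: eq_bigr => a _.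
  by rewrite rowK.
exists (fun a => y 0 a); split=> //.
move: ve; rewrite vE ip_suml (bigD1 i1) //= big1 => [|a a1].
  by rewrite he /= mulr1 addr0.
rewrite he /=; case: (ord_cases a) => [->|ai|]; first by rewrite /= mulr0.
  by rewrite ai eqxx in a1.
by case: a a1 => [[|[|a]] ha] //= _ _; rewrite mulr0.
Qed.

End NullFrame.

(** * Smooth functions on open subsets of affine space *)

Lemma Ck_on_sub (R : realType) n k (V W : set 'rV[R]_n) f :
  W `<=` V -> Ck_on k V f -> Ck_on k W f.
Proof.
move=> WV; elim: k f => [|k IH] f /=; first by move=> h x /WV /h.
by case=> df cf; split=> [x /WV /df|a]//; apply: IH.
Qed.

(** [g - f] vanishes near [x], so it has the zero differential there. *)
Lemma differentiable_near_eq (R : numFieldType) (V W : normedModType R)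
    (f g : V -> W) (x : V) :
  {near x, f =1 g} -> differentiable f x -> differentiable g x.
Proof.
move=> fg df; pose h : V -> W := g - f.
suff dh : differentiable h x.
  have -> : g = f + h by rewrite /h addrC subrK.
  exact: differentiableD.
have h0 : \forall y \near x, h y = 0.
  by near=> y; rewrite /h !fctE (near fg y) ?subrr.
have hx : h x = 0 by exact: (nbhs_singleton h0).
have hs : h \o shift x = cst (h x) + (\0 : V -> W) +o_ 0 id.
  apply/eqaddoP => _/posnumP[e].
  have := h0; rewrite (near_shift 0) /= subr0 => hs0.
  near=> y; rewrite /= !fctE hx.
  have -> : h (y + x) = 0 by near: y.
  by rewrite (_ : (\0 : V -> W) y = 0) // addr0 subr0 normr0 mulr_ge0.
have d0 : 'd h x = (\0 : V -> W) :> (V -> W).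
  by apply: diff_unique hs; exact: cst_continuous.
by apply/diff_locallyP; rewrite d0; split => //; exact: cst_continuous.
Unshelve. all: by end_near. Qed.

Section SmoothFunctions.
Variables (R : realType) (n : nat) (V : set 'rV[R]_n).
Hypothesis oV : open V.
Implicit Types f g : 'rV[R]_n -> R.

Let near_on (f g : 'rV[R]_n -> R) x : (forall y, V y -> f y = g y) -> V x ->
  \near x, f x = g x.
Proof.
move=> fg Vx; have : nbhs x V by exact: open_nbhs_nbhs.
by apply: filterS => y /fg.
Qed.

Lemma Ck_on_eq k f g : (forall x, V x -> f x = g x) ->
  Ck_on k V f -> Ck_on k V g.
Proof.
elim: k f g => [|k IH] f g fg /=.
  move=> cf x Vx; rewrite /prop_for /continuous_at -(fg x Vx).
  by apply: cvg_trans (cf x Vx); exact: (near_eq_cvg (near_on fg Vx)).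
case=> df cf; split=> [x Vx|a].
  by apply: differentiable_near_eq (df x Vx); apply: near_on.
apply: IH (cf a) => x Vx; apply: near_eq_derive; exact: near_on.
Qed.

Lemma Ck_onW k f : Ck_on k.+1 V f -> Ck_on k V f.
Proof.
elim: k f => [|k IH] f [df cf].
  by move=> x Vx; apply: differentiable_continuous; apply: df.
by split=> // a; apply: IH.
Qed.

Lemma Ck_on_cst k (c : R) : Ck_on k V (fun=> c).
Proof.
elim: k c => [|k IH] c /=; first by move=> x _; exact: cst_continuous.
split=> [x _|a]; first exact: differentiable_cst.
by apply: Ck_on_eq (IH 0) => x _; rewrite derive_cst.
Qed.

Lemma Ck_onD k f g : Ck_on k V f -> Ck_on k V g ->
  Ck_on k V (fun x => f x + g x).
Proof.
elim: k f g => [|k IH] f g /=.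
  by move=> cf cg x Vx; apply: continuousD; [apply: cf|apply: cg].
move=> [df cf] [dg cg]; split=> [x Vx|a].
  by apply: differentiableD; [apply: df|apply: dg].
apply: Ck_on_eq (IH _ _ (cf a) (cg a)) => x Vx /=.
by rewrite deriveD //; apply: diff_derivable; [apply: df|apply: dg].
Qed.

Lemma Ck_onM k f g : Ck_on k V f -> Ck_on k V g ->
  Ck_on k V (fun x => f x * g x).
Proof.
elim: k f g => [|k IH] f g.
  by move=> cf cg x Vx; apply: continuousM; [apply: cf|apply: cg].
move=> kf kg; have [df cf] := kf; have [dg cg] := kg; split=> [x Vx|a].
  by apply: differentiableM; [apply: df|apply: dg].
apply: Ck_on_eq (Ck_onD (IH _ _ (Ck_onW kf) (cg a)) (IH _ _ (Ck_onW kg) (cf a))).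
move=> x Vx /=.
by rewrite deriveM //; apply: diff_derivable; [apply: df|apply: dg].
Qed.

Lemma Ck_onV k f : (forall x, V x -> f x != 0) -> Ck_on k V f ->
  Ck_on k V (fun x => (f x)^-1).
Proof.
move=> f0; elim: k => [|k IH].
  by move=> cf x Vx; apply: continuousV; [apply: f0|apply: cf].
move=> kf; have [df cf] := kf; split=> [x Vx|a].
  by apply: differentiableV; [apply: df|apply: f0].
have ki := IH (Ck_onW kf).
apply: Ck_on_eq (Ck_onM (Ck_onM (Ck_on_cst k (-1)) (Ck_onM ki ki)) (cf a)).
move=> x Vx /=; rewrite deriveV ?f0 //; last by apply: diff_derivable; apply: df.
by rewrite mulN1r -invfM.
Qed.

Lemma smooth_on_eq f g : (forall x, V x -> f x = g x) ->
  smooth_on V f -> smooth_on V g.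
Proof. by move=> fg sf k; apply: Ck_on_eq (sf k). Qed.

Lemma smooth_on_cst c : smooth_on V (fun=> c).
Proof. by move=> k; apply: Ck_on_cst. Qed.

Lemma smooth_onD f g : smooth_on V f -> smooth_on V g ->
  smooth_on V (fun x => f x + g x).
Proof. by move=> sf sg k; apply: Ck_onD. Qed.

Lemma smooth_onM f g : smooth_on V f -> smooth_on V g ->
  smooth_on V (fun x => f x * g x).
Proof. by move=> sf sg k; apply: Ck_onM. Qed.

Lemma smooth_onV f : (forall x, V x -> f x != 0) -> smooth_on V f ->
  smooth_on V (fun x => (f x)^-1).
Proof. by move=> f0 sf k; apply: Ck_onV. Qed.

Lemma smooth_on_derive f a : smooth_on V f ->
  smooth_on V (fun x => 'D_(delta_mx 0 a) f x).
Proof. by move=> sf k; have [_ h] := sf k.+1; apply: h. Qed.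

Lemma smooth_on_differentiable f x : V x -> smooth_on V f -> differentiable f x.
Proof. by move=> Vx sf; have [df _] := sf 1%N; apply: df. Qed.

End SmoothFunctions.

Section Schwarz.
Variables (R : realType) (n : nat).
Implicit Types (f : 'rV[R]_n -> R) (x u w : 'rV[R]_n).

(** The difference quotients of the two derivatives are the same function. *)
Lemma is_derive_along_line f x u (s : R) : differentiable f (x + s *: u) ->
  is_derive s 1 (fun s : R => f (x + s *: u)) ('D_u f (x + s *: u)).
Proof.
move=> /(@diff_derivable _ _ _ _ _ u).
rewrite /derivable /derive => df.
set g := (fun h : R => h^-1 *: ((f \o shift (x + s *: u)) (h *: u) - f (x + s *: u))) in df *.
have e : (fun h : R => h^-1 *: (((fun s : R => f (x + s *: u)) \o shift s) (h *: 1)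
   - f (x + s *: u))) = g.
  apply/funext => h; rewrite /g /= [h *: 1]mulr1 scalerDl addrCA.
  by [].
by split; rewrite /derivable /derive e.
Qed.

(** The mean value theorem, in the direction [u] and then in the direction [w]. *)
Lemma second_difference f x u w (h : R) : 0 < h ->
  (forall s t, 0 <= s <= h -> 0 <= t <= h ->
    differentiable f (x + s *: u + t *: w) /\
    differentiable (fun y => 'D_u f y) (x + s *: u + t *: w)) ->
  exists s t, [/\ 0 <= s <= h, 0 <= t <= h &
    f (x + h *: u + h *: w) - f (x + h *: u) - (f (x + h *: w) - f x)
    = 'D_w (fun y => 'D_u f y) (x + s *: u + t *: w) * h * h].
Proof.
move=> h0 hd; have hh : 0 <= h <= h by rewrite ltW //=.
have h00 : 0 <= (0 : R) <= h by rewrite lexx ltW.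
pose phi s := f (x + h *: w + s *: u) - f (x + s *: u).
have dphi s : 0 <= s <= h -> is_derive s 1 phi
   ('D_u f (x + h *: w + s *: u) - 'D_u f (x + s *: u)).
  move=> sh; apply: is_deriveB; apply: is_derive_along_line.
    by rewrite addrAC; have [] := hd s h sh hh.
  by have [] := hd s 0 sh h00; rewrite scale0r addr0.
have [||s sh es] := @MVT _ phi
    (fun s => 'D_u f (x + h *: w + s *: u) - 'D_u f (x + s *: u)) 0 h h0.
- by move=> s; rewrite in_itv /= => /andP[s0 s1]; apply: dphi; rewrite !ltW.
- apply: derivable_within_continuous => s; rewrite in_itv /= => sh.
  by have [] := dphi s sh.
move: sh; rewrite in_itv /= => /andP[/ltW s0 /ltW s1].
have sh : 0 <= s <= h by rewrite s0.
pose psi t := 'D_u f (x + s *: u + t *: w).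
have dpsi t : 0 <= t <= h -> is_derive t 1 psi
   ('D_w (fun y => 'D_u f y) (x + s *: u + t *: w)).
  move=> th; apply: (@is_derive_along_line (fun y => 'D_u f y)).
  by have [] := hd s t sh th.
have [||t th et] := @MVT _ psi
    (fun t => 'D_w (fun y => 'D_u f y) (x + s *: u + t *: w)) 0 h h0.
- by move=> t; rewrite in_itv /= => /andP[t0 t1]; apply: dpsi; rewrite !ltW.
- apply: derivable_within_continuous => t; rewrite in_itv /= => th.
  by have [] := dpsi t th.
move: th; rewrite in_itv /= => /andP[/ltW t0 /ltW t1].
exists s, t; split; rewrite ?s0 ?t0 //.
move: es et; rewrite /phi /psi !scale0r !addr0 !subr0 => es et.
rewrite -et [x + s *: u + _]addrAC -es.
by rewrite [x + h *: u + _]addrAC.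
Qed.

Lemma eq_of_approx (A B : 'rV[R]_n -> R) x :
  {for x, continuous A} -> {for x, continuous B} ->
  (forall P : set 'rV[R]_n, nbhs x P -> exists y z, [/\ P y, P z & A y = B z]) ->
  A x = B x.
Proof.
move=> cA cB h; apply/eqP; rewrite -subr_eq0 -normr_eq0; apply/eqP/le_anti.
rewrite normr_ge0 andbT; apply/ler_addgt0Pr => e e0; rewrite add0r.
pose e2 := e / 2; have e20 : 0 < e2 by rewrite divr_gt0.
have /h : \forall y \near x, `|A x - A y| < e2 /\ `|B x - B y| < e2.
  near=> y; split; near: y; first by move/cvgrPdist_lt: cA; apply.
  by move/cvgrPdist_lt: cB; apply.
case=> y [z [[hA _] [_ hB] eAB]].
have -> : A x - B x = (A x - A y) - (B x - B z) by rewrite eAB; ring.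
apply: le_trans (ler_normB _ _) _.
by rewrite (splitr e) lerD // ltW.
Unshelve. all: by end_near. Qed.

(** Schwarz's theorem.  The second difference of [f] along two directions does not
    depend on their order; by [second_difference] it equals both mixed
    derivatives at points arbitrarily close to [x]. *)
Lemma derive_comm (V : set 'rV[R]_n) f x (a b : 'I_n) :
  open V -> V x -> smooth_on V f ->
  'D_(delta_mx 0 a) (fun y => 'D_(delta_mx 0 b) f y) x =
  'D_(delta_mx 0 b) (fun y => 'D_(delta_mx 0 a) f y) x.
Proof.
move=> oV Vx sf.
have sfa : smooth_on V (fun y => 'D_(delta_mx 0 a) f y) by exact: smooth_on_derive.
have sfb : smooth_on V (fun y => 'D_(delta_mx 0 b) f y) by exact: smooth_on_derive.
have sfab := smooth_on_derive b sfa; have sfba := smooth_on_derive a sfb.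
apply: (eq_of_approx (sfba 0%N x Vx) (sfab 0%N x Vx)) => P xP.
have d0 c y : V y -> smooth_on V (fun y => 'D_(delta_mx 0 c) f y) ->
    differentiable f y /\ differentiable (fun y => 'D_(delta_mx 0 c) f y) y.
  by move=> Vy sc; split; apply: (smooth_on_differentiable Vy).
move: (d0 a) (d0 b) => {d0} da db.
move: (delta_mx 0 a : 'rV[R]_n) (delta_mx 0 b : 'rV[R]_n) sfa sfb da db {sfab sfba}.
move=> u w sfa sfb da db.
have : \forall y \near x, P y /\ V y.
  by near=> y; split; near: y => //; exact: open_nbhs_nbhs.
case/nbhs_normP => r /= r0 hr.
pose C := `|u| + `|w| + 1.
have C0 : 0 < C by rewrite /C ltr_wpDl // addr_ge0.
pose h := r / 2 / C.
have h0 : 0 < h by rewrite !divr_gt0.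
have hin s t : 0 <= s <= h -> 0 <= t <= h ->
    P (x + s *: u + t *: w) /\ V (x + s *: u + t *: w).
  move=> /andP[s0 s1] /andP[t0 t1]; apply: hr => /=.
  rewrite -addrA opprD addrA subrr add0r normrN.
  apply: le_lt_trans (ler_normD _ _) _; rewrite !normrZ.
  rewrite (ger0_norm s0) (ger0_norm t0).
  apply: le_lt_trans (_ : h * C < r).
    rewrite /C !mulrDr mulr1 ler_wpDr ?(ltW h0) //.
    by rewrite lerD // ler_wpM2r.
  by rewrite /h divfK ?gt_eqF // ltr_pdivrMr // ltr_pMr // ltr1n.
have [|s [t [sh th e1]]] := @second_difference f x u w h h0.
  by move=> s t sh th; have [_ Vy] := hin s t sh th; apply: da.
have [|t' [s' [th' sh' e2]]] := @second_difference f x w u h h0.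
  by move=> t' s' th' sh'; have [_ Vy] := hin s' t' sh' th'; rewrite addrAC; apply: db.
exists (x + s' *: u + t' *: w), (x + s *: u + t *: w).
split; [by have [] := hin _ _ sh' th'|by have [] := hin _ _ sh th|].
have hN : h != 0 by rewrite gt_eqF.
rewrite [x + t' *: w + _]addrAC in e2.
apply: (mulIf hN); apply: (mulIf hN); apply: etrans (esym e2) (etrans _ e1).
rewrite [x + h *: w + h *: u]addrAC !opprB [LHS]addrACA [RHS]addrACA.
by congr (_ + _); exact: addrC.
Unshelve. all: by end_near. Qed.

(** Stated for maps given by their components, as transition functions are. *)
Lemma derive_chain f (G : 'rV[R]_n -> 'rV[R]_n) x v :
  (forall b, differentiable (fun y => G y 0 b) x) -> differentiable f (G x) ->
  differentiable (f \o G) x /\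
  'D_v (f \o G) x =
    \sum_b 'D_v (fun y => G y 0 b) x * 'D_(delta_mx 0 b) f (G x).
Proof.
move=> dG df.
have GE : G = \sum_b (fun y => G y 0 b *: delta_mx 0 b).
  by apply/funext => y; rewrite fct_sumE [LHS]row_sum_delta.
have dG' : differentiable G x.
  by rewrite GE; apply: differentiable_sum => b; exact: differentiableZl.
split; first exact: differentiable_comp.
have GvE : 'd G x v = \sum_b 'D_v (fun y => G y 0 b) x *: delta_mx 0 b.
  rewrite -(deriveE v dG') (derive_mx (@diff_derivable _ _ _ _ _ v dG')) [LHS]row_sum_delta.
  by apply: eq_bigr => b _; rewrite mxE.
rewrite (deriveE v (differentiable_comp dG' df)) (diff_comp dG' df) /= GvE.
rewrite linear_sum; apply: eq_bigr => b _.
by rewrite linearZ /= (deriveE _ df).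
Qed.

End Schwarz.

(** * Calculus in charts *)

Section Chart.
Variables (R : realType) (n : nat) (M : manifold R n) (i : chart M).
Implicit Types (V : set M) (f h : M -> R) (p : M).

Lemma open_chart_image V : open V -> V `<=` dom i -> open (coord i @` V).
Proof.
move=> oV Vi; rewrite openE => _ [p Vp <-].
have c1 : nbhs (coord i p) (coord i @` dom i).
  apply: open_nbhs_nbhs; split; first exact: coord_open.
  by exists p => //; apply: Vi.
have c2 : nbhs (coord i p) (param i @^-1` V).
  apply: (param_continuous (Vi p Vp)); rewrite coordK; last exact: Vi.
  exact: open_nbhs_nbhs.
rewrite /interior; apply: filterS (filterI c1 c2) => x [[q qi <-]].
by rewrite /= coordK // => Vq; exists q.
Qed.

Definition difat f p := differentiable (f \o param i) (coord i p).

Section OnOpen.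
Variables (V : set M) (oV : open V) (Vi : V `<=` dom i).

Let oc : open (coord i @` V). Proof. exact: open_chart_image. Qed.

Let on_image f h : (forall q, V q -> f q = h q) ->
  forall x, (coord i @` V) x -> (f \o param i) x = (h \o param i) x.
Proof. by move=> fh _ [q Vq <-] /=; rewrite coordK ?fh //; apply: Vi. Qed.

Let on_near f h p : V p -> (forall q, V q -> f q = h q) ->
  {near coord i p, f \o param i =1 h \o param i}.
Proof.
move=> Vp fh; have : nbhs (coord i p) (coord i @` V).
  by apply: open_nbhs_nbhs; split => //; exists p.
by apply: filterS; exact: on_image.
Qed.

Lemma pd_eq_on a f h p : V p -> (forall q, V q -> f q = h q) ->
  pd i a f p = pd i a h p.
Proof. by move=> Vp fh; apply: near_eq_derive; exact: on_near. Qed.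

Lemma difat_eq_on f h p : V p -> (forall q, V q -> f q = h q) ->
  difat f p -> difat h p.
Proof. by move=> Vp fh; apply: differentiable_near_eq; exact: on_near. Qed.

Lemma smooth_in_eq f h : (forall q, V q -> f q = h q) ->
  smooth_in i V f -> smooth_in i V h.
Proof. by move=> fh; apply: smooth_on_eq => //; exact: on_image. Qed.

Lemma smooth_in_cst c : smooth_in i V (fun=> c).
Proof. exact: smooth_on_cst. Qed.

Lemma smooth_inD f h : smooth_in i V f -> smooth_in i V h ->
  smooth_in i V (fun q => f q + h q).
Proof. exact: smooth_onD. Qed.

Lemma smooth_inM f h : smooth_in i V f -> smooth_in i V h ->
  smooth_in i V (fun q => f q * h q).
Proof. exact: smooth_onM. Qed.

Lemma smooth_inN f : smooth_in i V f -> smooth_in i V (fun q => - f q).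
Proof.
move=> sf; apply: smooth_in_eq (smooth_inM (smooth_in_cst (-1)) sf) => q _.
by rewrite mulN1r.
Qed.

Lemma smooth_inV f : (forall q, V q -> f q != 0) -> smooth_in i V f ->
  smooth_in i V (fun q => (f q)^-1).
Proof.
move=> f0; apply: (smooth_onV oc) => _ [q Vq <-] /=.
by rewrite coordK ?f0 //; apply: Vi.
Qed.

Lemma smooth_in_sum I (r : seq I) (P : pred I) (F : I -> M -> R) :
  (forall a, P a -> smooth_in i V (F a)) ->
  smooth_in i V (fun q => \sum_(a <- r | P a) F a q).
Proof.
move=> sF; elim: r => [|a r IH].
  by apply: smooth_in_eq (smooth_in_cst 0) => q _; rewrite big_nil.
have [Pa|Pa] := boolP (P a).
  by apply: smooth_in_eq (smooth_inD (sF a Pa) IH) => q _; rewrite big_cons Pa.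
by apply: smooth_in_eq IH => q _; rewrite big_cons (negPf Pa).
Qed.

Lemma smooth_in_prod I (r : seq I) (P : pred I) (F : I -> M -> R) :
  (forall a, P a -> smooth_in i V (F a)) ->
  smooth_in i V (fun q => \prod_(a <- r | P a) F a q).
Proof.
move=> sF; elim: r => [|a r IH].
  by apply: smooth_in_eq (smooth_in_cst 1) => q _; rewrite big_nil.
have [Pa|Pa] := boolP (P a).
  by apply: smooth_in_eq (smooth_inM (sF a Pa) IH) => q _; rewrite big_cons Pa.
by apply: smooth_in_eq IH => q _; rewrite big_cons (negPf Pa).
Qed.

Lemma smooth_in_pd a f : smooth_in i V f -> smooth_in i V (pd i a f).
Proof.
move=> /(smooth_on_derive a); apply: smooth_on_eq => // _ [q Vq <-] /=.
by rewrite /pd coordK //; apply: Vi.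
Qed.

Lemma smooth_in_difat f p : V p -> smooth_in i V f -> difat f p.
Proof. by move=> Vp; apply: smooth_on_differentiable; exists p. Qed.

Lemma smooth_in_near_neq0 f p : V p -> smooth_in i V f -> f p != 0 ->
  \forall q \near p, f q != 0.
Proof.
move=> Vp sf f0.
have cf : {for p, continuous ((f \o param i) \o coord i)}.
  apply: continuous_comp; first exact: (coord_continuous (Vi Vp)).
  exact/differentiable_continuous/smooth_in_difat.
have e0 : (f \o param i \o coord i) p != 0 by rewrite /= coordK //; apply: Vi.
have n1 : \forall q \near p, (f \o param i \o coord i) q != 0.
  exact: cvgr_neq0 cf e0.
have n2 : nbhs p V by exact: open_nbhs_nbhs.
by apply: filterS (filterI n1 n2) => q [/= fq Vq]; rewrite coordK in fq => //; apply: Vi.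
Qed.

Lemma pd_comm a b f p : V p -> smooth_in i V f ->
  pd i a (pd i b f) p = pd i b (pd i a f) p.
Proof.
move=> Vp sf.
have e c d : pd i c (pd i d f) p =
    'D_(delta_mx 0 c) (fun y => 'D_(delta_mx 0 d) (f \o param i) y) (coord i p).
  apply: near_eq_derive; have : nbhs (coord i p) (coord i @` V).
    by apply: open_nbhs_nbhs; split => //; exists p.
  by apply: filterS => _ [q Vq <-] /=; rewrite /pd coordK //; apply: Vi.
by rewrite !e; apply: (derive_comm a b oc) => //; exists p.
Qed.

End OnOpen.

Lemma difat_cst c p : difat (fun=> c) p.
Proof. exact: differentiable_cst. Qed.

Lemma difatD f h p : difat f p -> difat h p -> difat (fun q => f q + h q) p.
Proof. exact: differentiableD. Qed.

Lemma difatM f h p : difat f p -> difat h p -> difat (fun q => f q * h q) p.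
Proof. exact: differentiableM. Qed.

Lemma difat_sum I (r : seq I) (F : I -> M -> R) p :
  (forall a, difat (F a) p) -> difat (fun q => \sum_(a <- r) F a q) p.
Proof.
move=> dF; elim: r => [|a r IH].
  rewrite (_ : (fun q => _) = fun=> 0); first exact: difat_cst.
  by apply/funext => q; rewrite big_nil.
rewrite (_ : (fun q => _) = fun q => F a q + \sum_(a <- r) F a q).
  exact: difatD.
by apply/funext => q; rewrite big_cons.
Qed.

Lemma pd_cst a c p : pd i a (fun=> c) p = 0.
Proof. exact: derive_cst. Qed.

Lemma pdD a f h p : difat f p -> difat h p ->
  pd i a (fun q => f q + h q) p = pd i a f p + pd i a h p.
Proof. by move=> df dh; apply: deriveD; exact: diff_derivable. Qed.

Lemma pdM a f h p : dom i p -> difat f p -> difat h p ->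
  pd i a (fun q => f q * h q) p = pd i a f p * h p + f p * pd i a h p.
Proof.
move=> pi df dh.
have e := @deriveM _ _ (f \o param i) (h \o param i) (coord i p) (delta_mx 0 a)
  (diff_derivable df) (diff_derivable dh).
apply: etrans e _; rewrite /= coordK // addrC; congr (_ + _).
by rewrite /GRing.scale /= mulrC.
Qed.

Lemma pd_sum a I (r : seq I) (F : I -> M -> R) p :
  (forall b, difat (F b) p) ->
  pd i a (fun q => \sum_(b <- r) F b q) p = \sum_(b <- r) pd i a (F b) p.
Proof.
move=> dF; elim: r => [|b r IH].
  rewrite big_nil (_ : (fun q => _) = fun=> 0); first exact: pd_cst.
  by apply/funext => q; rewrite big_nil.
rewrite big_cons -IH -pdD //; last exact: difat_sum.
by congr (pd i a _ p); apply/funext => q; rewrite big_cons.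
Qed.

(** The derivative of the coordinate expression of [f] along the constant vector
    [X], written so as to be linear in [X] even where [f] is not
    differentiable. *)
Definition dird (X : 'rV[R]_n) f p : R := \sum_c X 0 c * pd i c f p.

Lemma dird_delta c f p : dird (delta_mx 0 c) f p = pd i c f p.
Proof.
rewrite /dird (bigD1 c) //= big1 ?addr0 => [|b /negPf bc].
  by rewrite mxE !eqxx mul1r.
by rewrite mxE bc andbF mul0r.
Qed.

Lemma dird_cst X c p : dird X (fun=> c) p = 0.
Proof. by rewrite /dird big1 // => a _; rewrite pd_cst mulr0. Qed.

Lemma dird_eq_on V X f h p : open V -> V `<=` dom i -> V p ->
  (forall q, V q -> f q = h q) -> dird X f p = dird X h p.
Proof.
move=> oV Vi Vp fh; apply: eq_bigr => c _; congr (_ * _).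
exact: (pd_eq_on oV Vi).
Qed.

Lemma dirdM X f h p : dom i p -> difat f p -> difat h p ->
  dird X (fun q => f q * h q) p = dird X f p * h p + f p * dird X h p.
Proof.
move=> pi df dh; rewrite /dird mulr_suml mulr_sumr -big_split /=.
by apply: eq_bigr => c _; rewrite pdM //; ring.
Qed.

Lemma dird_sum X I (r : seq I) (F : I -> M -> R) p :
  (forall b, difat (F b) p) ->
  dird X (fun q => \sum_(b <- r) F b q) p = \sum_(b <- r) dird X (F b) p.
Proof.
move=> dF; rewrite /dird exchange_big /=; apply: eq_bigr => c _.
by rewrite pd_sum // mulr_sumr.
Qed.

Definition difmx m k (A : M -> 'M[R]_(m, k)) p :=
  forall a b, difat (fun q => A q a b) p.

Definition dmx m k X (A : M -> 'M[R]_(m, k)) p : 'M[R]_(m, k) :=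
  \matrix_(a, b) dird X (fun q => A q a b) p.

Lemma dmx_cst m k X (A : 'M[R]_(m, k)) p : dmx X (fun=> A) p = 0.
Proof. by apply/matrixP => a b; rewrite !mxE dird_cst. Qed.

Lemma difmx_cst m k (A : 'M[R]_(m, k)) p : difmx (fun=> A) p.
Proof. by move=> a b; exact: difat_cst. Qed.

Lemma dmxT m k X (A : M -> 'M[R]_(m, k)) p :
  dmx X (fun q => (A q)^T) p = (dmx X A p)^T.
Proof.
apply/matrixP => a b; rewrite !mxE; congr (dird X _ p).
by apply/funext => q; rewrite mxE.
Qed.

Lemma difmxT m k (A : M -> 'M[R]_(m, k)) p :
  difmx A p -> difmx (fun q => (A q)^T) p.
Proof.
move=> dA a b; have := dA b a; rewrite /difat.
by congr (differentiable _ _); apply/funext => q; rewrite /= mxE.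
Qed.

Lemma difmxM m k l (A : M -> 'M[R]_(m, k)) (B : M -> 'M[R]_(k, l)) p :
  difmx A p -> difmx B p -> difmx (fun q => A q *m B q) p.
Proof.
move=> dA dB a b.
rewrite (_ : (fun q => _) = fun q => \sum_c A q a c * B q c b); last first.
  by apply/funext => q; rewrite mxE.
by apply: difat_sum => c; apply: difatM.
Qed.

Lemma dmxM m k l X (A : M -> 'M[R]_(m, k)) (B : M -> 'M[R]_(k, l)) p :
  dom i p -> difmx A p -> difmx B p ->
  dmx X (fun q => A q *m B q) p = dmx X A p *m B p + A p *m dmx X B p.
Proof.
move=> pi dA dB; apply/matrixP => a b; rewrite !mxE.
rewrite (_ : (fun q => _) = fun q => \sum_c A q a c * B q c b); last first.
  by apply/funext => q; rewrite mxE.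
rewrite dird_sum => [|c]; last exact: difatM.
by rewrite -big_split; apply: eq_bigr => c _; rewrite dirdM // !mxE.
Qed.

Lemma dmx_eq_on V m k X (A B : M -> 'M[R]_(m, k)) p :
  open V -> V `<=` dom i -> V p ->
  (forall q, V q -> A q = B q) -> dmx X A p = dmx X B p.
Proof.
move=> oV Vi Vp AB; apply/matrixP => a b; rewrite !mxE.
by apply: (dird_eq_on _ oV Vi) => // q Vq; rewrite AB.
Qed.

Lemma dmx_lin m k (A : M -> 'M[R]_(m, k)) X p :
  dmx X A p = \sum_c X 0 c *: dmx (delta_mx 0 c) A p.
Proof.
apply/matrixP => a b; rewrite summxE mxE; apply: eq_bigr => c _.
by rewrite !mxE dird_delta.
Qed.

Lemma dird_ip X (A : M -> 'M[R]_n) (u v : M -> 'rV[R]_n) p :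
  dom i p -> difmx A p -> difmx u p -> difmx v p ->
  dird X (fun q => ip (A q) (u q) (v q)) p =
  ip (dmx X A p) (u p) (v p) + ip (A p) (dmx X u p) (v p)
  + ip (A p) (u p) (dmx X v p).
Proof.
move=> pi dA du dv.
transitivity (dmx X (fun q => u q *m A q *m (v q)^T) p 0 0).
  by rewrite mxE.
rewrite dmxM //; [|exact: difmxM|exact: difmxT].
rewrite dmxM // dmxT /ip mulmxDl mxE [X in X + _ = _]mxE.
by congr (_ + _); rewrite addrC.
Qed.

Lemma difat_ip (A : M -> 'M[R]_n) (u v : M -> 'rV[R]_n) p :
  difmx A p -> difmx u p -> difmx v p -> difat (fun q => ip (A q) (u q) (v q)) p.
Proof.
move=> dA du dv.
have d : difmx (fun q => u q *m A q *m (v q)^T) p.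
  by apply: difmxM; [exact: difmxM|exact: difmxT].
exact: d.
Qed.

Lemma dird_tr k X (A : M -> 'M[R]_k) p : difmx A p ->
  dird X (fun q => \tr (A q)) p = \tr (dmx X A p).
Proof.
move=> dA; rewrite /mxtrace dird_sum //.
by apply: eq_bigr => a _; rewrite mxE.
Qed.

End Chart.

Section TwoCharts.
Variables (R : realType) (n : nat) (M : manifold R n) (i j : chart M) (p : M).
Hypotheses (pi : dom i p) (pj : dom j p).

Let V := dom j `&` dom i.
Let oV : open V. Proof. by apply: openI; exact: dom_open. Qed.
Let Vj : V `<=` dom j. Proof. by move=> q []. Qed.

Lemma smooth_in_coord b : smooth_in j V (fun q => coord i q 0 b).
Proof. exact: transition_smooth. Qed.

Lemma difmx_jac : difmx j (jac j i) p.
Proof.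
move=> a b; apply: (difat_eq_on oV Vj (f := pd j a (fun q => coord i q 0 b))) => //.
  by move=> q _; rewrite mxE.
apply: (smooth_in_difat (V := V)) => //; apply: smooth_in_pd => //.
exact: smooth_in_coord.
Qed.

Let chain v f : difat i f p ->
  difat j f p /\ 'D_v (f \o param j) (coord j p) =
    \sum_b 'D_v ((fun q => coord i q 0 b) \o param j) (coord j p) * pd i b f p.
Proof.
move=> df.
have e : {near coord j p, (f \o param i) \o (coord i \o param j) =1 f \o param j}.
  have : nbhs (coord j p) (coord j @` V).
    by apply: open_nbhs_nbhs; split; [exact: open_chart_image|exists p].
  by apply: filterS => _ [q [qj qi] <-] /=; rewrite coordK // coordK.
have cp : (coord i \o param j) (coord j p) = coord i p by rewrite /= coordK.
have [||d1 d2] := @derive_chain R n (f \o param i) (coord i \o param j)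
    (coord j p) v.
- move=> b; apply: (@smooth_in_difat _ _ _ j V (fun q => coord i q 0 b)) => //.
  exact: smooth_in_coord.
- by rewrite cp.
split; first exact: (differentiable_near_eq e d1).
by rewrite -(near_eq_derive _ e) d2 cp.
Qed.

Lemma difat_chain f : difat i f p -> difat j f p.
Proof. by case/(chain 0). Qed.

Lemma pd_chain a f : difat i f p ->
  pd j a f p = \sum_b jac j i p a b * pd i b f p.
Proof.
case/(chain (delta_mx 0 a)) => _ e; apply: etrans e _.
by apply: eq_bigr => b _; rewrite mxE.
Qed.

Lemma dird_chain X f : difat i f p -> dird j X f p = dird i (X *m jac j i p) f p.
Proof.
move=> df; rewrite /dird.
under eq_bigr do rewrite (pd_chain _ df) mulr_sumr.
rewrite exchange_big /=; apply: eq_bigr => b _; rewrite mxE mulr_suml.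
by apply: eq_bigr => a _; rewrite mulrA.
Qed.

Lemma dmx_chain m k X (A : M -> 'M[R]_(m, k)) : difmx i A p ->
  difmx j A p /\ dmx j X A p = dmx i (X *m jac j i p) A p.
Proof.
move=> dA; split=> [a b|]; first exact: difat_chain.
by apply/matrixP => a b; rewrite !mxE dird_chain.
Qed.

(** The entries of the Jacobian are first derivatives of the transition functions,
    so this is the symmetry of their second derivatives. *)
Lemma dmx_jac_sym (X Z : 'rV[R]_n) :
  X *m dmx j Z (jac j i) p = Z *m dmx j X (jac j i) p.
Proof.
have e c a b : pd j c (fun q => jac j i q a b) p
    = pd j c (pd j a (fun q => coord i q 0 b)) p.
  by apply: (pd_eq_on oV Vj) => // q _; rewrite mxE.
apply/rowP => b; rewrite !mxE.
under eq_bigr do rewrite mxE mulr_sumr.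
under [RHS]eq_bigr do rewrite mxE mulr_sumr.
rewrite exchange_big /=; apply: eq_bigr => c _; apply: eq_bigr => a _.
by rewrite !e (pd_comm oV Vj c a) //; [ring|exact: smooth_in_coord].
Qed.

End TwoCharts.

(** * Levi-Civita connection and Ricci tensor *)

Section SmoothMatrix.
Variables (R : realType) (n : nat) (M : manifold R n) (i : chart M).
Variables (V : set M) (oV : open V) (Vi : V `<=` dom i).

Lemma smooth_in_det m (A : M -> 'M[R]_m) :
  (forall a b, smooth_in i V (fun q => A q a b)) ->
  smooth_in i V (fun q => \det (A q)).
Proof.
move=> sA; apply: smooth_in_sum => // s _; apply: smooth_inM => //.
  exact: smooth_in_cst.
by apply: smooth_in_prod.
Qed.

Lemma smooth_in_invmx m (A : M -> 'M[R]_m) :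
  (forall q, V q -> A q \in unitmx) ->
  (forall a b, smooth_in i V (fun q => A q a b)) ->
  forall a b, smooth_in i V (fun q => invmx (A q) a b).
Proof.
move=> uA sA a b.
apply: (smooth_in_eq oV Vi (f := fun q => (\det (A q))^-1 *
  ((-1) ^+ (b + a) * \det (row' b (col' a (A q)))))).
  by move=> q Vq; rewrite /invmx uA // !mxE.
apply: smooth_inM => //.
  apply: smooth_inV => //; last exact: smooth_in_det.
  by move=> q Vq; have := uA q Vq; rewrite unitmxE unitfE.
apply: smooth_inM => //; first exact: smooth_in_cst.
apply: smooth_in_det => x y.
by apply: (smooth_in_eq oV Vi) (sA (lift b x) (lift a y)) => q _; rewrite !mxE.
Qed.

End SmoothMatrix.

Lemma trmxE (R : Type) m n (A : 'M[R]_(m, n)) a b : A^T a b = A b a.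
Proof. by rewrite mxE. Qed.

(** Index bookkeeping for [ricci_sym], with [G x y z] for the Christoffel symbols
    and [P c x y z] for their derivatives. *)
Lemma ricci_formula_sym (R : comPzRingType) n (P : 'I_n -> 'I_n -> 'I_n -> 'I_n -> R)
    (G : 'I_n -> 'I_n -> 'I_n -> R) :
  (forall x y z, G x y z = G x z y) ->
  (forall c x y z, P c x y z = P c x z y) ->
  (forall b d, \sum_a P d a a b = \sum_a P b a a d) ->
  forall b d,
  \sum_a (P a a b d - P b a a d + \sum_e (G a a e * G e b d - G a b e * G e a d))
  = \sum_a (P a a d b - P d a a b + \sum_e (G a a e * G e d b - G a d e * G e a b)).
Proof.
move=> sG sP tP b d; rewrite !big_split /= !sumrN (tP d b); congr (_ - _ + _).
  by apply: eq_bigr => a _; rewrite sP.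
under eq_bigr do rewrite sumrB.
under [RHS]eq_bigr do rewrite sumrB.
rewrite !sumrB; congr (_ - _).
  by apply: eq_bigr => a _; apply: eq_bigr => e _; rewrite [in X in _ * X = _]sG.
rewrite exchange_big; apply: eq_bigr => a _; apply: eq_bigr => e _ /=.
by rewrite [LHS]mulrC [in X in X * _ = _]sG [in X in _ * X = _]sG.
Qed.

Section Metric.
Variables (R : realType) (n : nat) (M : manifold R n) (g : lorentz_metric M).
Variable (i : chart M).

Let oi : open (dom i). Proof. exact: dom_open. Qed.
Let ii : dom i `<=` dom i. Proof. by []. Qed.

Lemma minkowski_unit : minkowski R n \in unitmx.
Proof.
rewrite unitmxE det_diag unitfE prodf_seq_neq0; apply/allP => a _ /=.
by rewrite mxE; case: ifP => _; rewrite ?oppr_eq0 oner_eq0.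
Qed.

Lemma gm_unit p : dom i p -> gm g i p \in unitmx.
Proof.
move=> /(gm_lorentz g)[P _ e]; have := minkowski_unit.
by rewrite -e !unitmx_mul => /andP[/andP[]].
Qed.

Lemma ginv_sym p : dom i p -> (ginv g i p)^T = ginv g i p.
Proof. by move=> pi; rewrite /ginv trmx_inv gm_sym. Qed.

Lemma smooth_in_gm a b : smooth_in i (dom i) (fun q => gm g i q a b).
Proof. exact: gm_smooth. Qed.

Lemma smooth_in_ginv a b : smooth_in i (dom i) (fun q => ginv g i q a b).
Proof.
apply: (smooth_in_invmx oi ii); [exact: gm_unit|exact: smooth_in_gm].
Qed.

Lemma smooth_in_christoffel c a b : smooth_in i (dom i) (christoffel g i c a b).
Proof.
apply: smooth_inM => //; first exact: smooth_in_cst.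
apply: smooth_in_sum => // d _; apply: smooth_inM => //.
  exact: smooth_in_ginv.
have sp x y z : smooth_in i (dom i) (pd i x (fun q => gm g i q y z)).
  by apply: smooth_in_pd => //; exact: smooth_in_gm.
by apply: smooth_inD => //; [exact: smooth_inD|exact: smooth_inN].
Qed.

Lemma smooth_in_riemann a b c d : smooth_in i (dom i) (riemann g i a b c d).
Proof.
have sG := smooth_in_christoffel.
have sp x y z t : smooth_in i (dom i) (pd i x (christoffel g i y z t)).
  by apply: smooth_in_pd.
apply: smooth_inD => //.
  by apply: smooth_inD => //; exact: smooth_inN.
apply: smooth_in_sum => // e _.
by apply: smooth_inD => //; [|apply: smooth_inN => //]; apply: smooth_inM.
Qed.

Lemma smooth_in_ricci a b : smooth_in i (dom i) (fun q => ricci g i q a b).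
Proof.
apply: (smooth_in_eq oi ii (f := fun q => \sum_c riemann g i c a c b q)).
  by move=> q _; rewrite mxE.
by apply: smooth_in_sum => // c _; exact: smooth_in_riemann.
Qed.

Lemma smooth_in_tracefree_ricci a b :
  smooth_in i (dom i) (fun q => tracefree_ricci g i q a b).
Proof.
apply: (smooth_in_eq oi ii (f := fun q => ricci g i q a b +
  - (scalar_curvature g i q * n%:R^-1 * gm g i q a b))).
  by move=> q _; rewrite !mxE.
apply: smooth_inD => //; first exact: smooth_in_ricci.
apply: smooth_inN => //; apply: smooth_inM => //; last exact: smooth_in_gm.
apply: smooth_inM => //; last exact: smooth_in_cst.
apply: smooth_in_sum => // x _; apply: smooth_in_sum => // y _.
by apply: smooth_inM => //; [exact: smooth_in_ginv|exact: smooth_in_ricci].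
Qed.

Lemma difmx_smooth m k (A : M -> 'M[R]_(m, k)) (V : set M) p :
  open V -> V `<=` dom i -> V p ->
  (forall a b, smooth_in i V (fun q => A q a b)) -> difmx i A p.
Proof. by move=> oV Vi Vp sA a b; apply: (smooth_in_difat (V := V)). Qed.

Section Point.
Variable (p : M).
Hypothesis pi : dom i p.

Lemma dmx_gm_sym X : (dmx i X (gm g i) p)^T = dmx i X (gm g i) p.
Proof.
rewrite -dmxT; apply: (dmx_eq_on _ oi) => // q qi.
exact: gm_sym.
Qed.

(** The bilinear part of the connection: [nabla_X Z] is the derivative of [Z]
    along [X] plus this vector. *)
Definition christoffel_map (X Z : 'rV[R]_n) : 'rV[R]_n :=
  \row_b \sum_a \sum_c X 0 a * Z 0 c * christoffel g i b a c p.

Lemma nabla_vecE (k : M -> 'rV[R]_n) X :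
  nabla_vec g i k p X = dmx i X k p + christoffel_map X (k p).
Proof.
apply/rowP => b; rewrite !mxE -big_split; apply: eq_bigr => a _ /=.
rewrite mulrDr mulr_sumr; congr (_ + _); apply: eq_bigr => c _; ring.
Qed.

Lemma koszul X Z Y : ip (gm g i p) (christoffel_map X Z) Y =
  2^-1 * (ip (dmx i X (gm g i) p) Z Y + ip (dmx i Z (gm g i) p) X Y
          - ip (dmx i Y (gm g i) p) X Z).
Proof.
pose w : 'rV[R]_n := \row_d (2^-1 * (ip (dmx i X (gm g i) p) Z (delta_mx 0 d)
  + ip (dmx i Z (gm g i) p) X (delta_mx 0 d)
  - ip (dmx i (delta_mx 0 d) (gm g i) p) X Z)).
(* The factor [g^-1] is split off, leaving the covector [w] of the Koszul formula. *)
have -> : christoffel_map X Z = w *m (ginv g i p)^T.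
  apply/rowP => b; rewrite !mxE /christoffel.
  under eq_bigr do under eq_bigr do rewrite mulrCA mulr_sumr mulr_sumr.
  under eq_bigr do rewrite exchange_big.
  rewrite exchange_big; apply: eq_bigr => d _ /=.
  rewrite !mxE mulrAC -[RHS]mulrA.
  rewrite !ip_delta ipE.
  have e1 : \sum_c Z 0 c * dmx i X (gm g i) p c d =
      \sum_a \sum_c X 0 a * Z 0 c * pd i a (fun q => gm g i q c d) p.
    rewrite exchange_big; apply: eq_bigr => c _; rewrite mxE mulr_sumr.
    by apply: eq_bigr => a _; ring.
  have e2 : \sum_c X 0 c * dmx i Z (gm g i) p c d =
      \sum_a \sum_c X 0 a * Z 0 c * pd i c (fun q => gm g i q a d) p.
    apply: eq_bigr => a _; rewrite mxE mulr_sumr.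
    by apply: eq_bigr => c _; ring.
  rewrite e1 e2 -big_split -sumrB mulr_sumr mulr_sumr.
  apply: eq_bigr => a _ /=.
  rewrite -big_split -sumrB mulr_sumr mulr_sumr; apply: eq_bigr => c _ /=.
  by rewrite mxE dird_delta; ring.
rewrite ginv_sym // ipMl /ginv mulVmx ?gm_unit //.
rewrite [ip _ _ _]mxE.
under eq_bigr do rewrite mulmx1 !mxE -mulrA mulrDl mulrDl mulNr.
rewrite -mulr_sumr !big_split /= sumrN !ip_sum_delta.
congr (_ * (_ - _)); rewrite [in RHS]dmx_lin ip_mx_sum.
by apply: eq_bigr => d _; rewrite mulrC.
Qed.

(** [nabla g = 0]: add the Koszul formulas for [(X, Z, Y)] and [(X, Y, Z)]. *)
Lemma metric_compat X Z Y : ip (dmx i X (gm g i) p) Z Y =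
  ip (gm g i p) (christoffel_map X Z) Y + ip (gm g i p) Z (christoffel_map X Y).
Proof.
rewrite [in X in _ = _ + X]ipC ?gm_sym // !koszul.
rewrite (ipC Y Z (dmx_gm_sym X)).
by field.
Qed.

Lemma pd_gm_sym c a b : pd i c (fun q => gm g i q a b) p =
  pd i c (fun q => gm g i q b a) p.
Proof.
by apply: (pd_eq_on oi ii) => // q qi; rewrite -[in LHS]gm_sym // mxE.
Qed.

End Point.

Lemma christoffel_sym p c a b : dom i p ->
  christoffel g i c a b p = christoffel g i c b a p.
Proof.
move=> pi; congr (_ * _); apply: eq_bigr => d _; congr (_ * _).
by rewrite [pd i d _ p]pd_gm_sym // [X in X - _]addrC.
Qed.

(** The other two terms of the Christoffel symbol are exchanged by the two summed
    indices and cancel. *)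
Lemma trace_christoffel p b : dom i p -> \sum_a christoffel g i a a b p =
  2^-1 * \tr (ginv g i p *m dmx i (delta_mx 0 b) (gm g i) p).
Proof.
move=> pi; rewrite /christoffel -mulr_sumr; congr (_ * _).
have gs a d : ginv g i p a d = ginv g i p d a by rewrite -[in LHS]ginv_sym // mxE.
have e : \sum_a \sum_d ginv g i p a d * pd i a (fun q => gm g i q b d) p =
    \sum_a \sum_d ginv g i p a d * pd i d (fun q => gm g i q a b) p.
  rewrite exchange_big; apply: eq_bigr => a _; apply: eq_bigr => d _ /=.
  by rewrite gs [X in _ * X]pd_gm_sym.
transitivity (\sum_a \sum_d ginv g i p a d * pd i b (fun q => gm g i q a d) p).
  under eq_bigr do under eq_bigr do rewrite mulrBr mulrDr.
  under eq_bigr do rewrite sumrB big_split /=.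
  by rewrite sumrB big_split /= e addrC addrK.
apply: eq_bigr => a _; rewrite mxE; apply: eq_bigr => d _.
by rewrite mxE dird_delta pd_gm_sym.
Qed.

Lemma difmx_gm p : dom i p -> difmx i (gm g i) p.
Proof. by move=> pi; apply: (difmx_smooth oi) => // a b; exact: smooth_in_gm. Qed.

Lemma difmx_ginv p : dom i p -> difmx i (ginv g i) p.
Proof. by move=> pi; apply: (difmx_smooth oi) => // a b; exact: smooth_in_ginv. Qed.

Lemma dmx_ginv p X : dom i p -> dmx i X (ginv g i) p =
  - (ginv g i p *m dmx i X (gm g i) p *m ginv g i p).
Proof.
move=> pi.
have : dmx i X (fun q => ginv g i q *m gm g i q) p = 0.
  rewrite (dmx_eq_on _ oi (B := fun=> 1%:M)) ?dmx_cst // => q qi.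
  by rewrite /ginv mulVmx // gm_unit.
rewrite dmxM //; [|exact: difmx_ginv|exact: difmx_gm].
move=> /(congr1 (mulmx^~ (ginv g i p))); rewrite mul0mx mulmxDl -mulmxA.
rewrite {2}/ginv mulmxV ?gm_unit // mulmx1 => /eqP.
by rewrite addr_eq0 => /eqP.
Qed.

(** Differentiating the trace of [g^-1 (d_b g)] along [d] produces the trace of
    [g^-1 (d_d d_b g)], symmetric by Schwarz's theorem, and minus the trace of
    [g^-1 (d_d g) g^-1 (d_b g)], symmetric by cyclicity. *)
Lemma pd_trace_christoffel_sym p b d : dom i p ->
  \sum_a pd i d (christoffel g i a a b) p = \sum_a pd i b (christoffel g i a a d) p.
Proof.
move=> pi.
have D2 x y : dmx i (delta_mx 0 x) (dmx i (delta_mx 0 y) (gm g i)) p =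
    \matrix_(a, c) pd i x (pd i y (fun q => gm g i q a c)) p.
  apply/matrixP => a c; rewrite !mxE dird_delta.
  by apply: (pd_eq_on oi ii) => // q _; rewrite mxE dird_delta.
have dD y : difmx i (dmx i (delta_mx 0 y) (gm g i)) p.
  apply: (difmx_smooth oi) => // a c.
  apply: (smooth_in_eq oi ii (f := pd i y (fun q => gm g i q a c))).
    by move=> q _; rewrite mxE dird_delta.
  by apply: smooth_in_pd => //; exact: smooth_in_gm.
have e x y : \sum_a pd i x (christoffel g i a a y) p =
    2^-1 * (\tr (ginv g i p *m (\matrix_(a, c) pd i x (pd i y (fun q => gm g i q a c)) p))
   - \tr (ginv g i p *m dmx i (delta_mx 0 x) (gm g i) p
          *m (ginv g i p *m dmx i (delta_mx 0 y) (gm g i) p))).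
  rewrite -pd_sum; last first.
    by move=> a; apply: (smooth_in_difat (V := dom i)) => //; exact: smooth_in_christoffel.
  rewrite (@pd_eq_on _ _ _ i _ oi ii x _ (fun q => 2^-1 *
    \tr (ginv g i q *m dmx i (delta_mx 0 y) (gm g i) q)) p pi); last first.
    by move=> q qi; rewrite trace_christoffel.
  have dP := difmxM (difmx_ginv pi) (dD y).
  rewrite -dird_delta dirdM //; [|exact: difat_cst|]; last first.
    by apply: difat_sum => a; exact: dP.
  rewrite dird_cst mul0r add0r dird_tr //; congr (_ * _).
  rewrite dmxM //; last exact: difmx_ginv.
  by rewrite linearD /= addrC D2 dmx_ginv // mulNmx linearN /= !mulmxA.
have eD : \matrix_(a, c) pd i d (pd i b (fun q => gm g i q a c)) p =
    \matrix_(a, c) pd i b (pd i d (fun q => gm g i q a c)) p.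
  apply: eq_mx => a c.
  exact: (pd_comm oi ii d b pi (smooth_in_gm a c)).
apply: etrans (e d b) (etrans _ (esym (e b d))).
apply: (congr2 (fun x y => 2^-1 * (x - y))); last exact: mxtrace_mulC.
exact: (congr1 (fun H => \tr (ginv g i p *m H)) eD).
Qed.

Lemma ricciE p b d : ricci g i p b d = \sum_a riemann g i a b a d p.
Proof. by rewrite mxE. Qed.

(** Apart from the contracted Christoffel symbols, every term of the coordinate
    formula is symmetric because the connection is torsion-free. *)
Lemma ricci_sym p : dom i p -> (ricci g i p)^T = ricci g i p.
Proof.
move=> pi; apply/matrixP => b d.
apply: etrans (trmxE _ _ _) _.
apply: etrans (ricciE _ _ _) (etrans _ (esym (ricciE _ _ _))).
apply: (@ricci_formula_sym _ _ (fun c x y z => pd i c (christoffel g i x y z) p)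
  (fun x y z => christoffel g i x y z p)).
- by move=> x y z; exact: christoffel_sym.
- move=> c x y z; apply: (pd_eq_on oi ii) pi _ => q qi.
  exact: christoffel_sym.
- by move=> x y; exact: pd_trace_christoffel_sym.
Qed.

Lemma tracefree_ricci_sym p : dom i p ->
  (tracefree_ricci g i p)^T = tracefree_ricci g i p.
Proof. by move=> pi; rewrite /tracefree_ricci linearB linearZ /= ricci_sym // gm_sym. Qed.

End Metric.

(** * Boost order conditions as identities *)

(** Index bookkeeping for [nablaS_formE], with [D] for the partial derivatives of
    [S] and [Gm] for the Christoffel symbols. *)
Lemma cov_derivative_ip (R : realType) n (D Gm : 'I_n -> 'I_n -> 'I_n -> R)
    (S : 'M[R]_n) (u v w : 'rV[R]_n) :
  \sum_c \sum_a \sum_b u 0 c * v 0 a * w 0 b *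
    (D c a b - \sum_d (Gm d c a * S d b + Gm d c b * S a d)) =
  ip (\matrix_(a, b) \sum_c u 0 c * D c a b) v w
  - ip S (\row_d \sum_c \sum_a u 0 c * v 0 a * Gm d c a) w
  - ip S v (\row_d \sum_c \sum_b u 0 c * w 0 b * Gm d c b).
Proof.
rewrite !ipE.
have e1 : \sum_a \sum_b v 0 a * w 0 b *
      (\matrix_(a, b) (\sum_c u 0 c * D c a b)) a b =
    \sum_c \sum_a \sum_b u 0 c * v 0 a * w 0 b * D c a b.
  rewrite [RHS]exchange_big; apply: eq_bigr => a _ /=.
  rewrite [RHS]exchange_big; apply: eq_bigr => b _ /=.
  by rewrite mxE mulr_sumr; apply: eq_bigr => c _; ring.
have e2 : \sum_d \sum_b (\row_d (\sum_c \sum_a u 0 c * v 0 a * Gm d c a)) 0 d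
       * w 0 b * S d b =
    \sum_c \sum_a \sum_b u 0 c * v 0 a * w 0 b * \sum_d Gm d c a * S d b.
  transitivity (\sum_c \sum_d \sum_a \sum_b
     u 0 c * v 0 a * w 0 b * (Gm d c a * S d b)); last first.
    apply: eq_bigr => c _; rewrite exchange_big; apply: eq_bigr => a _ /=.
    by rewrite exchange_big; apply: eq_bigr => b _ /=; rewrite mulr_sumr.
  rewrite [RHS]exchange_big; apply: eq_bigr => d _ /=.
  under eq_bigr do rewrite mxE mulr_suml mulr_suml.
  rewrite exchange_big; apply: eq_bigr => c _ /=.
  rewrite [RHS]exchange_big; apply: eq_bigr => b _ /=.
  by rewrite mulr_suml mulr_suml; apply: eq_bigr => a _; ring.
have e3 : \sum_a \sum_d v 0 a *
      (\row_d (\sum_c \sum_b u 0 c * w 0 b * Gm d c b)) 0 d * S a d =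
    \sum_c \sum_a \sum_b u 0 c * v 0 a * w 0 b * \sum_d Gm d c b * S a d.
  rewrite [RHS]exchange_big; apply: eq_bigr => a _ /=.
  transitivity (\sum_c \sum_d \sum_b
     u 0 c * v 0 a * w 0 b * (Gm d c b * S a d)); last first.
    apply: eq_bigr => c _; rewrite exchange_big; apply: eq_bigr => b _ /=.
    by rewrite mulr_sumr.
  rewrite [RHS]exchange_big; apply: eq_bigr => d _ /=.
  rewrite mxE mulr_sumr mulr_suml; apply: eq_bigr => c _.
  by rewrite mulr_sumr mulr_suml; apply: eq_bigr => b _; ring.
rewrite e1 e2 e3 -!sumrB; apply: eq_bigr => c _.
rewrite -!sumrB; apply: eq_bigr => a _; rewrite -!sumrB; apply: eq_bigr => b _.
by rewrite big_split /=; ring.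
Qed.

Section Forms.
Variables (R : realType) (n : nat) (M : manifold R n) (g : lorentz_metric M).
Variables (i : chart M) (p : M) (c : {vspace 'rV[R]_n}) (k : 'rV[R]_n).
Hypotheses (hn : (2 <= n)%N) (pi : dom i p).
Hypotheses (kc : k \in c) (k0 : k != 0) (kk : ip (gm g i p) k k = 0).

Let i0 : 'I_n := Ordinal (ltnW hn).
Let i1 : 'I_n := Ordinal hn.

Lemma nablaS_formE (u v w : 'rV[R]_n) : nablaS_form g i p [tuple u; v; w] =
  ip (dmx i u (tracefree_ricci g i) p) v w
  - ip (tracefree_ricci g i p) (christoffel_map g i p u v) w
  - ip (tracefree_ricci g i p) v (christoffel_map g i p u w).
Proof. exact: cov_derivative_ip. Qed.

(** A vector orthogonal to [k = e_0] has no component along [e_1], and the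
    components of [S] on [(e_0, e_b)] with [b != 1] have positive boost weight. *)
Lemma S_orth_null Y :
  boost_order_le (gm g i p) c (S_form g i p) 0 ->
  ip (gm g i p) k Y = 0 -> ip (tracefree_ricci g i p) k Y = 0.
Proof.
move=> bo kY.
have [e fe ek] := null_frame_exists hn (gm_lorentz g pi) kc k0 kk.
rewrite (ipC _ _ (gm_sym g pi)) -ek in kY.
have [x [-> x1]] := null_frame_coord fe kY.
rewrite ip_sumr big1 // => b _.
have [->|b1] := eqVneq b i1; first by rewrite x1 mul0r.
rewrite ipE [X in _ * X](_ : _ = 0) ?mulr0 //; apply/eqP; apply: contraT => ne.
have := bo e fe [tuple i0; b]; rewrite /S_form /= ek => /(_ ne).
rewrite /boost_weight /=; case: (ord_cases hn b) => [->|bi|b2] //.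
  by rewrite bi eqxx in b1.
by case: b b2 {b1 ne} => [[|[|b]] hb].
Qed.

(** As in [S_orth_null]: the components of [nabla S] on [(e_a, e_0, e_b)] with
    [a] and [b] different from 1 have positive boost weight, so
    [(nabla_X S)(k, Y) = 0]. *)
Lemma nablaS_orth_null X Y :
  boost_order_le (gm g i p) c (nablaS_form g i p) 0 ->
  ip (gm g i p) X k = 0 -> ip (gm g i p) k Y = 0 ->
  ip (dmx i X (tracefree_ricci g i) p) k Y =
  ip (tracefree_ricci g i p) (christoffel_map g i p X k) Y
  + ip (tracefree_ricci g i p) k (christoffel_map g i p X Y).
Proof.
move=> bo Xk kY.
suff : nablaS_form g i p [tuple X; k; Y] = 0.
  by rewrite nablaS_formE => e; apply/eqP; rewrite -subr_eq0 opprD addrA e.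
have [e fe ek] := null_frame_exists hn (gm_lorentz g pi) kc k0 kk.
rewrite (ipC _ _ (gm_sym g pi)) in kY; rewrite -ek in kY Xk.
have [x [-> x1]] := null_frame_coord fe Xk.
have [y [-> y1]] := null_frame_coord fe kY.
pose T (a b d : 'I_n) := nabla_cov2 g i (tracefree_ricci g i) p a b d.
have Te (u v w : 'rV[R]_n) : nablaS_form g i p [tuple u; v; w] =
    \sum_a u 0 a * ip (\matrix_(b, d) T a b d) v w.
  apply: eq_bigr => a _; rewrite ipE mulr_sumr; apply: eq_bigr => b _.
  by rewrite mulr_sumr; apply: eq_bigr => d _; rewrite mxE /= !mulrA.
have e0 a b : a != i1 -> b != i1 -> nablaS_form g i p [tuple e a; k; e b] = 0.
  move=> a1 b1; apply/eqP; apply: contraT => ne.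
  have := bo e fe [tuple a; i0; b].
  rewrite (_ : map_tuple e _ = [tuple e a; k; e b]); last first.
    by apply: val_inj; rewrite /= ek.
  move=> /(_ ne); rewrite /boost_weight /=.
  have h z : z != i1 -> (val z == 1%N) = false by move/negPf.
  by rewrite (h a a1) (h b b1); case: (val a == 0%N); case: (val b == 0%N).
rewrite Te.
have -> : \sum_a (\sum_a0 x a0 *: e a0) 0 a *
    ip (\matrix_(b, d) T a b d) k (\sum_b y b *: e b) =
  \sum_a0 \sum_b x a0 * y b * nablaS_form g i p [tuple e a0; k; e b].
  transitivity (\sum_a \sum_a0 \sum_b x a0 * y b *
     (e a0 0 a * ip (\matrix_(b, d) T a b d) k (e b))).
    apply: eq_bigr => a _; rewrite summxE ip_sumr mulr_suml; apply: eq_bigr => a0 _.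
    rewrite mxE mulr_sumr; apply: eq_bigr => b _; ring.
  rewrite exchange_big; apply: eq_bigr => a0 _ /=.
  rewrite exchange_big; apply: eq_bigr => b _ /=.
  by rewrite Te mulr_sumr.
rewrite big1 // => a _; rewrite big1 // => b _.
have [->|a1] := eqVneq a i1; first by rewrite x1 !mul0r.
have [->|b1] := eqVneq b i1; first by rewrite y1 mulr0 mul0r.
by rewrite e0 // mulr0.
Qed.

End Forms.

(** * The covariant derivative of the congruence *)

Section OneChart.
Variables (R : realType) (n : nat) (M : manifold R n) (g : lorentz_metric M).
Variables (i : chart M) (V : set M) (k : M -> 'rV[R]_n) (p : M).
Hypotheses (oV : open V) (Vi : V `<=` dom i) (Vp : V p) (dk : difmx i k p).

Local Notation S := (tracefree_ricci g i).
Local Notation G := (gm g i).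

Let pi : dom i p. Proof. exact: Vi. Qed.
Let dG : difmx i G p. Proof. exact: difmx_gm. Qed.
Let dS : difmx i S p.
Proof.
apply: (@difmx_smooth _ _ _ i _ _ _ (dom i)) => //; first exact: dom_open.
by move=> a b; exact: smooth_in_tracefree_ricci.
Qed.

(** Differentiate [g(k, k) = 0]. *)
Lemma nabla_vec_null X : (forall q, V q -> ip (G q) (k q) (k q) = 0) ->
  ip (G p) (nabla_vec g i k p X) (k p) = 0.
Proof.
move=> kk.
have : dird i X (fun q => ip (G q) (k q) (k q)) p = 0.
  by rewrite (dird_eq_on _ oV Vi Vp kk) dird_cst.
rewrite dird_ip // metric_compat // nabla_vecE ipDl.
rewrite [ip _ (k p) (christoffel_map _ _ _ _ _)]ipC ?gm_sym //.
rewrite [ip _ (k p) (dmx _ _ _ _)]ipC ?gm_sym //.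
move: (ip _ _ _) (ip _ _ _) => a b e.
by lra.
Qed.

(** That [k] is an eigenvector reads [S(k, Y) g(k, l) = S(k, l) g(k, Y)] for
    constant [Y] and [l].  Differentiating this form involves no derivative of
    the eigenvalue, and the derivatives of [g(k, l)] and [S(k, l)] come
    multiplied by [S(k, Y)] and [g(k, Y)], which vanish at [p].
    The Christoffel terms in [Y] cancel because [S(k, .) = lam g(k, .)]. *)
Lemma nabla_vec_eigen lam X Y l :
  (forall q Z, V q -> ip (G q) (k q) Z = 0 -> ip (S q) (k q) Z = 0) ->
  k p *m S p = lam *: (k p *m G p) -> ip (G p) (k p) l != 0 ->
  ip (dmx i X S p) (k p) Y =
    ip (S p) (christoffel_map g i p X (k p)) Y + ip (S p) (k p) (christoffel_map g i p X Y) ->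
  ip (G p) (k p) Y = 0 ->
  ip (S p) (nabla_vec g i k p X) Y = lam * ip (G p) (nabla_vec g i k p X) Y.
Proof.
move=> orth kS kl nS kY.
have kSE Z : ip (S p) (k p) Z = lam * ip (G p) (k p) Z.
  by rewrite [LHS]ip_dot kS ipZl -ip_dot.
have F0 q : V q -> ip (S q) (k q) Y * ip (G q) (k q) l =
    ip (S q) (k q) l * ip (G q) (k q) Y.
  move=> Vq; have [m0|m0] := eqVneq (ip (G q) (k q) l) 0.
    by rewrite m0 (orth _ _ Vq m0) mulr0 mul0r.
  have := orth q (Y - (ip (G q) (k q) Y / ip (G q) (k q) l) *: l) Vq.
  rewrite -!(scaleNr _ l) !(ipDr, ipZr) mulNr divfK // subrr => /(_ erefl) e.
  move/eqP: e; rewrite addr_eq0 mulNr opprK => /eqP ->.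
  by rewrite -mulrA [ip (S q) _ l * _]mulrC mulrA divfK // mulrC.
have dc (Z : 'rV[R]_n) : difmx i (fun=> Z) p by exact: difmx_cst.
have dS1 Z : difat i (fun q => ip (S q) (k q) Z) p by exact: difat_ip (dc Z).
have dG1 Z : difat i (fun q => ip (G q) (k q) Z) p by exact: difat_ip (dc Z).
have := dird_eq_on X oV Vi Vp F0.
rewrite dirdM // [RHS]dirdM // kY mulr0 add0r kSE kY mulr0 mul0r addr0 kSE.
rewrite !(dird_ip X pi _ dk (dc Y)) // !dmx_cst !ip0r !addr0.
rewrite -mulrA [ip (G p) (k p) l * _]mulrC mulrA => /(mulIf kl).
rewrite nS metric_compat // nabla_vecE !ipDl kSE => e.
by rewrite [LHS]addrC mulrDr; move: e; rewrite !mulrDr; lra.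
Qed.

End OneChart.

Section Transformation.
Variables (R : realType) (n : nat) (M : manifold R n) (g : lorentz_metric M).
Variables (i j : chart M) (V : set M) (ki kj : M -> 'rV[R]_n) (p : M).
Hypotheses (oV : open V) (Vp : V p) (pi : dom i p) (pj : dom j p).
Hypotheses (dki : difmx i ki p) (dkj : difmx j kj p).
Hypothesis kij : forall q, V q -> dom i q -> dom j q ->
  ki q = kj q *m jac j i q.

Local Notation J := (jac j i p).
Local Notation DJ X := (dmx j X (jac j i) p).

Let W := V `&` (dom i `&` dom j).
Let oW : open W. Proof. by do 2!apply: openI => //; exact: dom_open. Qed.
Let Wj : W `<=` dom j. Proof. by move=> q [_ []]. Qed.
Let Wp : W p. Proof. by []. Qed.

Lemma gm_ip X Y : ip (gm g j p) X Y = ip (gm g i p) (X *m J) (Y *m J).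
Proof. by rewrite (gm_tensor g pj pi) ip_mulmx. Qed.

Lemma dmx_gm_chain X Z Y : ip (dmx j X (gm g j) p) Z Y =
  ip (gm g i p) (Z *m DJ X) (Y *m J)
  + ip (dmx i (X *m J) (gm g i) p) (Z *m J) (Y *m J)
  + ip (gm g i p) (Z *m J) (Y *m DJ X).
Proof.
have [dgj dge] := dmx_chain pi pj X (difmx_gm g pi).
have dJ := difmx_jac pi pj.
rewrite (dmx_eq_on _ oW Wj Wp
  (B := fun q => jac j i q *m gm g i q *m (jac j i q)^T)); last first.
  by move=> q [_ [qi qj]]; exact: gm_tensor.
rewrite dmxM //; [|exact: difmxM|exact: difmxT].
rewrite dmxM // dmxT dge mulmxDl !ipDm !ip_mulmx.
by [].
Qed.

Lemma dmx_section_chain X :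
  dmx j X kj p *m J = dmx i (X *m J) ki p - kj p *m DJ X.
Proof.
have [dkj' dke] := dmx_chain pi pj X dki.
have dJ := difmx_jac pi pj.
rewrite -dke [dmx j X ki p](dmx_eq_on _ oW Wj Wp (B := fun q => kj q *m jac j i q)).
  by rewrite dmxM // addrK.
by move=> q [Vq [qi qj]]; exact: kij.
Qed.

(** The second derivatives of the transition function enter through the
    derivative of [k] and through the three terms of the Koszul formula; by
    [dmx_jac_sym] they cancel. *)
Lemma nabla_vec_chain X Y :
  ip (gm g j p) (nabla_vec g j kj p X) Y =
  ip (gm g i p) (nabla_vec g i ki p (X *m J)) (Y *m J).
Proof.
rewrite !nabla_vecE !ipDl !koszul // [ip _ (dmx j X kj p) Y]gm_ip.
rewrite dmx_section_chain !dmx_gm_chain (kij Vp pi pj) -scaleN1r ipDl ipZl.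
rewrite (dmx_jac_sym pi pj (kj p) X) (dmx_jac_sym pi pj (kj p) Y).
rewrite (dmx_jac_sym pi pj X Y).
have sG := gm_sym g pi.
by rewrite [ip _ (kj p *m J) (Y *m DJ X)]ipC //; field.
Qed.

End Transformation.

Section Main.
Variables (R : realType) (n : nat) (hn : (2 <= n)%N) (M : manifold R n).
Variables (g : lorentz_metric M) (c : null_congruence g).
Hypotheses (hS : bo_S_le c 0) (hnS : bo_nablaS_le c 0).

Local Notation S i := (tracefree_ricci g i).

Lemma S_orth i p k Y : dom i p -> k \in line c i p -> k != 0 ->
  ip (gm g i p) k Y = 0 -> ip (S i p) k Y = 0.
Proof.
move=> pi kl k0; apply: (S_orth_null hn pi kl k0); last exact: hS.
exact: (line_null pi kl).
Qed.

Lemma nablaS_orth i p k X Y : dom i p -> k \in line c i p -> k != 0 ->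
  ip (gm g i p) X k = 0 -> ip (gm g i p) k Y = 0 ->
  ip (dmx i X (S i) p) k Y =
  ip (S i p) (christoffel_map g i p X k) Y + ip (S i p) k (christoffel_map g i p X Y).
Proof.
move=> pi kl k0; apply: (nablaS_orth_null hn pi kl k0); last exact: hnS.
exact: (line_null pi kl).
Qed.

(** At [p] the bordered matrix of a local smooth section is invertible; its
    determinant is a smooth function, hence non-zero on a neighborhood. *)
Lemma isolated_near p i : generic_type_II c p -> dom i p ->
  exists U : set M, [/\ open U, U p, U `<=` dom i &
    forall q k, U q -> k \in line c i q -> k != 0 ->
      isolated (S i q) (gm g i q) k].
Proof.
move=> gen pi.
have [V [k [oV Vp Vi sk lk]]] := line_smooth c pi.
have kl q : V q -> k q \in line c i q by move=> Vq; rewrite lk // memv_line.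
have k0 q : V q -> k q != 0.
  move=> Vq; have := line_dim c (Vi _ Vq); rewrite lk // dim_vline.
  by case: eqP.
have sg a b : smooth_in i V (fun q => gm g i q a b).
  by move=> m; apply: Ck_on_sub (smooth_in_gm g i a b m) => _ [q /Vi qi <-]; exists q.
have sS a b : smooth_in i V (fun q => S i q a b).
  move=> m; apply: Ck_on_sub (smooth_in_tracefree_ricci g i a b m).
  by move=> _ [q /Vi qi <-]; exists q.
have [lam [eig rk]] := gen i pi.
have uG q : V q -> gm g i q \in unitmx by move=> /Vi; exact: gm_unit.
have sG q : V q -> (gm g i q)^T = gm g i q by move=> /Vi; exact: gm_sym.
have sSy q : V q -> (S i q)^T = S i q by move=> /Vi; exact: tracefree_ricci_sym.
have kk q : V q -> ip (gm g i q) (k q) (k q) = 0.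
  by move=> Vq; apply: line_null (kl q Vq); exact: Vi.
have kS : k p *m S i p = lam *: (k p *m gm g i p).
  have := eig _ (kl p Vp); rewrite /S_endo /ginv mulmxA.
  move=> /(congr1 (mulmx^~ (gm g i p))); rewrite mulmxKV ?uG // => ->.
  by rewrite -scalemxAl.
have iso := isolated_of_rank (ltnW hn) (uG p Vp) (sG p Vp) (sSy p Vp) (k0 p Vp)
  (kk p Vp) kS rk.
have [l klp] := ip_neq0 (uG p Vp) (k0 p Vp).
have uB := isolated_bordered (sSy p Vp) (sG p Vp) klp kS (kk p Vp) iso.
have sip (A : M -> 'M[R]_n) (u v : M -> 'rV[R]_n) :
    (forall a b, smooth_in i V (fun q => A q a b)) ->
    (forall a, smooth_in i V (fun q => u q 0 a)) ->
    (forall a, smooth_in i V (fun q => v q 0 a)) ->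
    smooth_in i V (fun q => ip (A q) (u q) (v q)).
  move=> sA su sv.
  apply: (smooth_in_eq oV Vi (f := fun q => \sum_a \sum_b u q 0 a * v q 0 b * A q a b)).
    by move=> q _; rewrite ipE.
  apply: smooth_in_sum => // a _; apply: smooth_in_sum => // b _.
  by apply: smooth_inM => //; apply: smooth_inM.
have sl a : smooth_in i V (fun=> l 0 a) by exact: smooth_in_cst.
have smul (u : M -> 'rV[R]_n) : (forall a, smooth_in i V (fun q => u q 0 a)) ->
    forall b, smooth_in i V (fun q => (u q *m gm g i q) 0 b).
  move=> su b.
  apply: (smooth_in_eq oV Vi (f := fun q => \sum_a u q 0 a * gm g i q a b)).
    by move=> q _; rewrite mxE.
  by apply: smooth_in_sum => // a _; apply: smooth_inM.
have sB : smooth_in i V (fun q => \det (bordered (S i q) (gm g i q) (k q) l)).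
  apply: (smooth_in_det oV Vi) => a b.
  apply: (smooth_in_eq oV Vi (f := fun q =>
    ip (gm g i q) (k q) l * S i q a b + - (ip (S i q) (k q) l * gm g i q a b)
    + ((k q *m gm g i q) 0 a * (l *m gm g i q) 0 b
       + (l *m gm g i q) 0 a * (k q *m gm g i q) 0 b))).
    by move=> q _; rewrite borderedE.
  have s1 := smul _ sk; have s2 := smul (fun=> l) sl.
  have s3 := sip _ _ _ sg sk sl; have s4 := sip _ _ _ sS sk sl.
  apply: smooth_inD => //.
    by apply: smooth_inD => //; [|apply: smooth_inN => //]; apply: smooth_inM.
  by apply: smooth_inD => //; apply: smooth_inM.
have n1 := smooth_in_near_neq0 oV Vi Vp (sip _ _ _ sg sk sl) klp.
have n2 : \forall q \near p, \det (bordered (S i q) (gm g i q) (k q) l) != 0.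
  apply: (smooth_in_near_neq0 oV Vi Vp sB).
  by move: uB; rewrite unitmxE unitfE.
have n3 : nbhs p V by exact: open_nbhs_nbhs.
exists ([set q | ip (gm g i q) (k q) l != 0] `&`
  [set q | \det (bordered (S i q) (gm g i q) (k q) l) != 0] `&` V)^°.
split; [exact: open_interior|exact: filterI (filterI n1 n2) n3| |].
  by move=> q /interior_subset[_ /Vi].
move=> q k' /interior_subset[[/= m1 m2] Vq] k'l k'0.
have [mu kS'] := eigen_of_orth m1 (fun v => @S_orth i q (k q) v (Vi _ Vq) (kl _ Vq) (k0 _ Vq)).
have isoq : isolated (S i q) (gm g i q) (k q).
  apply: (bordered_isolated (sG q Vq) m1 kS' (kk q Vq)).
  by rewrite unitmxE unitfE.
move: k'l k'0; rewrite lk // => /vlineP[a ->] ak.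
by apply: isolated_scale => //; apply: contraNneq ak => ->; rewrite scale0r.
Qed.

(** The argument is run in the chart [i] and its conclusion is moved to the
    chart [j] by pairing with an arbitrary vector. *)
Lemma kundt_of_isolated (U : set M) i : U `<=` dom i ->
  (forall q k, U q -> k \in line c i q -> k != 0 ->
      isolated (S i q) (gm g i q) k) -> kundt c U.
Proof.
move=> Ui iso V k oV VU [kl kt ks] j p Vp pj X Xl.
have pU := VU _ Vp; have pi := Ui _ pU.
have [kil ki0] := kl i p Vp pi; have [kjl kj0] := kl j p Vp pj.
have dk h : dom h p -> difmx h (k h) p.
  move=> ph; apply: (@difmx_smooth _ _ _ h _ _ _ (V `&` dom h)) => //.
  - by apply: openI => //; exact: dom_open.
  - by move=> a b; rewrite [a]ord1; exact: ks.
have kij q : V q -> dom i q -> dom j q -> k i q = k j q *m jac j i q.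
  by move=> Vq qi qj; apply: kt.
pose Y := X *m jac j i p.
have Yk : ip (gm g i p) Y (k i p) = 0.
  by rewrite kij // -gm_ip //; exact: Xl.
have Vi : V `<=` dom i by move=> q /VU /Ui.
have [l kil0] := ip_neq0 (gm_unit g pi) ki0.
have [lam kS] := eigen_of_orth kil0 (fun v => @S_orth i p (k i p) v pi kil ki0).
have [mu mue] : exists mu, nabla_vec g i (k i) p Y = mu *: k i p.
  apply: (isolated_multiple (gm_sym g pi) kil0 (iso p _ pU kil ki0) kS).
    apply: (nabla_vec_null oV Vi Vp (dk i pi)) => q Vq.
    by have [kq _] := kl i q Vq (Vi q Vq); apply: line_null kq; exact: Vi.
  move=> v kv.
  apply: (nabla_vec_eigen oV Vi Vp (dk i pi) _ kS kil0 _ kv).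
    move=> q Z Vq; have [kq kq0] := kl i q Vq (Vi q Vq).
    exact: (S_orth (Vi q Vq) kq kq0).
  exact: (nablaS_orth pi kil ki0 Yk kv).
exists mu; apply/eqP; rewrite -subr_eq0; apply/eqP.
apply: (ip_eq0P (gm_unit g pj)) => Z.
rewrite -scaleNr ipDl ipZl (nabla_vec_chain g oV Vp pi pj (dk i pi) (dk j pj) kij).
by rewrite -/Y mue ipZl (gm_ip g pi pj) -kij // mulNr subrr.
Qed.

End Main.

Theorem theorem2 (R : realType) (n : nat) (hn : (3 <= n)%N)
    (M : manifold R n) (g : lorentz_metric M) (c : null_congruence g)
    (hS : bo_S_le c 0) (p : M) (hp : generic_type_II c p)
    (hnS : bo_nablaS_le c 0) :
  exists U : set M, [/\ open U, U p & kundt c U].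
Proof.
have [i pi] := dom_cover p.
have [U [oU Up Ui iso]] := isolated_near (ltnW hn) hS hp pi.
by exists U; split => //; exact: (kundt_of_isolated (ltnW hn) hS hnS Ui iso).
Qed.
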